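(* Let $a>0$, $x>0$, let $\eta,\rho,\nu,c\in\mathbb{C}$ and let $\alpha<1$ be real, such that $\Re(\eta)>0$, $\Re(\rho)>0$, $\nu>-\frac{3}{2}$ (in particular $\nu$ is real) and $\Re\left(\frac{\eta}{1-\alpha}\right)>-1$. Assume that $t\mapsto t^{\rho-1}\mathtt{S}_{\nu,c}^{1}(t)$ is Lebesgue integrable on $\left(0,\frac{x}{a(1-\alpha)}\right)$. Then $$ P_{0+}^{(\eta,\alpha)}\left[t^{\rho-1}\mathtt{S}_{\nu,c}^{1}(t)\right](x)=x^{\eta}\left(\frac{x}{a(1-\alpha)}\right)^{\rho+\nu+1}\frac{\Gamma\left(1+\frac{\eta}{1-\alpha}\right)}{2^{\nu+1}}\;{}_{2}\Psi_{3}\left[\begin{array}{c}\left(\rho+\nu+1,2\right),\ (1,1)\\ \left(\rho+\nu+\frac{\eta}{1-\alpha}+2,2\right),\ \left(\nu+\frac32,1\right),\ \left(\frac32,1\right)\end{array}\bigg|\,-\frac{c\,x^{2}}{4\,a^{2}(1-\alpha)^{2}}\right]. $$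
   Context: The (classical, $\mathtt{k}=1$) Struve function with parameters $\nu,c$ is, for $t>0$, $$\mathtt{S}_{\nu,c}^{1}(t)=\sum_{r=0}^{\infty}\frac{(-c)^r}{\Gamma\left(r+\nu+\frac{3}{2}\right)\Gamma\left(r+\frac32\right)}\left(\frac{t}{2}\right)^{2r+\nu+1},$$ where $\Gamma$ is the Euler gamma function. The pathway fractional integral operator, with $a>0$, $\eta\in\mathbb{C}$, $\Re(\eta)>0$ and pathway parameter $\alpha<1$, is defined for $x>0$ and integrable $f$ by $$\left(P_{0+}^{(\eta,\alpha)}f\right)(x)=x^{\eta}\int_{0}^{\frac{x}{a(1-\alpha)}}\left[1-\frac{a(1-\alpha)t}{x}\right]^{\frac{\eta}{1-\alpha}}f(t)\,dt.$$ $P_{0+}^{(\eta,\alpha)}[f(t)](x)$ denotes $\left(P_{0+}^{(\eta,\alpha)}f\right)(x)$. Complex powers of positive reals are taken with the real logarithm. The generalized Wright hypergeometric function is $${}_{p}\Psi_{q}\left[\begin{array}{c}(a_1,\alpha_1),\dots,(a_p,\alpha_p)\\(b_1,\beta_1),\dots,(b_q,\beta_q)\end{array}\bigg|\,z\right]=\sum_{n=0}^{\infty}\frac{\prod_{i=1}^{p}\Gamma(a_i+\alpha_i n)}{\prod_{j=1}^{q}\Gamma(b_j+\beta_j n)}\frac{z^{n}}{n!},$$ with $a_i,b_j\in\mathbb{C}$ and $\alpha_i,\beta_j\in\mathbb{R}$; it is an entire function of $z$ when $\sum_{j}\beta_j-\sum_{i}\alpha_i>-1$. *)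

(* Defs.v *)
From mathcomp Require Export all_boot all_order all_algebra.
From mathcomp Require Export all_classical all_reals all_analysis.
Export Order.TTheory GRing.Theory Num.Theory.
Export numFieldNormedType.Exports.
(* Last, so that [Re] and [Im] are the projections of [R[i]] onto [R]. *)
From mathcomp Require Export complex.

Set Implicit Arguments.
Unset Strict Implicit.
Unset Printing Implicit Defensive.

Local Open Scope classical_set_scope.
Local Open Scope ring_scope.
Local Open Scope complex_scope.

Definition cexp (R : realType) (z : R[i]) : R[i] :=
  (expR (Re z))%:C * (cos (Im z) +i* sin (Im z)).

(* Meaningful for 0 < t only: [ln] is the real logarithm, and is 0 on
   nonpositive arguments. *)
Definition cpow (R : realType) (t : R) (z : R[i]) : R[i] :=
  cexp (z * (ln t)%:C).

(* [R[i]^o] carries the topology of the complex modulus. *)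
Definition cseries (R : realType) (u : nat -> R[i]) : R[i] :=
  limn (series u : nat -> R[i]^o).

Definition cintegrable (R : realType) (D : set R) (f : R -> R[i]) : Prop :=
  (@lebesgue_measure R).-integrable D (EFin \o (fun t => Re (f t))) /\
  (@lebesgue_measure R).-integrable D (EFin \o (fun t => Im (f t))).

Definition cintegral (R : realType) (D : set R) (f : R -> R[i]) : R[i] :=
  (\int[@lebesgue_measure R]_(t in D) Re (f t)) +i*
  (\int[@lebesgue_measure R]_(t in D) Im (f t)).

Definition Euler_integral (R : realType) (z : R[i]) : R[i] :=
  cintegral `]0, +oo[ (fun t : R => cpow t (z - 1) * (expR (- t))%:C).

(* Outside the half-plane 0 < Re z, the integral is continued by
   Gamma (z + n) = z (z + 1) ... (z + n - 1) Gamma z, where n is chosen so that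
   0 < Re (z + n). At a pole the product vanishes, so that Gamma z = 0 and
   (Gamma z)^-1 = 0: the latter is the value of the entire function 1 / Gamma. *)
Definition Gamma (R : realType) (z : R[i]) : R[i] :=
  if 0 < Re z then Euler_integral z
  else let n := (Num.truncn (- Re z)).+1 in
       Euler_integral (z + n%:R) / \prod_(k < n) (z + k%:R).

Definition struve (R : realType) (nu c : R[i]) (t : R) : R[i] :=
  cseries (fun r : nat =>
    (- c) ^+ r / (Gamma (r%:R + nu + 3 / 2) * Gamma (r%:R + 3 / 2))
    * cpow (t / 2) (2 * r%:R + nu + 1)).

Definition pathway (R : realType) (a : R) (eta : R[i]) (alpha : R)
    (f : R -> R[i]) (x : R) : R[i] :=
  cpow x eta *
  cintegral `]0, x / (a * (1 - alpha))[
    (fun t : R =>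
       cpow (1 - a * (1 - alpha) * t / x) (eta / (1 - alpha)%:C) * f t).

(* [A] and [B] list the pairs (a_i, alpha_i) and (b_j, beta_j). *)
Definition wright (R : realType) (A B : seq (R[i] * R)) (z : R[i]) : R[i] :=
  cseries (fun n : nat =>
    (\prod_(p <- A) Gamma (p.1 + p.2%:C * n%:R)) /
    (\prod_(q <- B) Gamma (q.1 + q.2%:C * n%:R)) * (z ^+ n / n`!%:R)).

(* Main.v *)
(* Integrate the Struve series term by term. The r-th term of the integrand is
   a constant times the beta kernel t^(p-1) (1 - t/X)^(q-1) on ]0, X[, with
   X = x / (a (1 - alpha)), p = rho + nu + 1 + 2r and q = 1 + eta / (1 - alpha),
   so its integral is X^p Gamma p Gamma q / Gamma (p + q), the r-th term of the
   Wright series up to a constant factor. The interchange is dominated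
   convergence: the partial sums are bounded by a multiple of
   t^(Re (rho + nu)).

   This needs 0 < Re (rho + nu + 1), which is not a hypothesis but follows from
   the integrability of t^(rho - 1) S(t): near 0 that function is equivalent to
   a nonzero multiple of t^(rho + nu).

   Beta integral: Gamma p * Gamma q is the integral of the convolution of the two
   gamma kernels (Fubini), and that convolution at w is
   w^(p+q-1) e^(-w) B(p, q). Since division by Gamma (p + q) is involved, one also
   needs that Gamma does not vanish on the right half-plane: see
   Gamma_neq0_large. *)

Require Import Defs.
From mathcomp Require Import measurable_realfun ring lra.

Set Implicit Arguments.
Unset Strict Implicit.
Unset Printing Implicit Defensive.

Import Normc.

Local Open Scope classical_set_scope.
Local Open Scope ring_scope.
Local Open Scope complex_scope.

(** * Real and imaginary parts, modulus, complex exponential and complex powers *)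

Section complex_basics.
Context {R : realType}.
Implicit Types (z w : R[i]) (r s t : R).

Lemma ReD z w : Re (z + w) = Re z + Re w.
Proof. by case: z; case: w. Qed.

Lemma ImD z w : Im (z + w) = Im z + Im w.
Proof. by case: z; case: w. Qed.

Lemma ReN z : Re (- z) = - Re z.
Proof. by case: z. Qed.

Lemma ImN z : Im (- z) = - Im z.
Proof. by case: z. Qed.

Lemma ReM z w : Re (z * w) = Re z * Re w - Im z * Im w.
Proof. by case: z; case: w. Qed.

Lemma ImM z w : Im (z * w) = Re z * Im w + Im z * Re w.
Proof. by case: z => a b; case: w. Qed.

Lemma normc_Re_le z : `|Re z| <= normc z.
Proof.
case: z => a b /=; rewrite -sqrtr_sqr ler_sqrt ?addr_ge0 ?sqr_ge0//.
by rewrite lerDl sqr_ge0.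
Qed.

Lemma normc_Im_le z : `|Im z| <= normc z.
Proof.
case: z => a b /=; rewrite -sqrtr_sqr ler_sqrt ?addr_ge0 ?sqr_ge0//.
by rewrite lerDr sqr_ge0.
Qed.

Lemma normc_ge0 z : 0 <= normc z.
Proof. by case: z => a b; exact: sqrtr_ge0. Qed.

Lemma normc_le_ReIm z : normc z <= `|Re z| + `|Im z|.
Proof.
case: z => a b /=; rewrite -[leRHS]ger0_norm ?addr_ge0//.
rewrite -sqrtr_sqr ler_sqrt ?sqr_ge0// sqrrD !real_normK ?num_real//.
by rewrite addrAC lerDl mulrn_wge0// mulr_ge0.
Qed.

Lemma normc_real r : normc r%:C = `|r|.
Proof. by rewrite /= expr0n addr0 sqrtr_sqr. Qed.

Lemma normc_eq0 z : (normc z == 0) = (z == 0).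
Proof. by apply/eqP/eqP => [/eq0_normc//|->]; rewrite normc0. Qed.

Lemma normcX z n : normc (z ^+ n) = normc z ^+ n.
Proof. by elim: n => [|n ih]; rewrite ?normc1// !exprS normcM ih. Qed.

Lemma cexpD z w : cexp (z + w) = cexp z * cexp w.
Proof.
rewrite /cexp ReD ImD expRD cosD sinD.
by apply/eqP; rewrite eq_complex /=; apply/andP; split; apply/eqP; ring.
Qed.

Lemma normc_cexp z : normc (cexp z) = expR (Re z).
Proof.
rewrite /cexp normcM normc_real ger0_norm ?expR_ge0//.
by rewrite /= cos2Dsin2 sqrtr1 mulr1.
Qed.

Lemma cexp_real r : cexp r%:C = (expR r)%:C.
Proof. by rewrite /cexp /= cos0 sin0 [1 +i* 0]/(1%:C) mulr1. Qed.

Lemma cpowD t z w : cpow t (z + w) = cpow t z * cpow t w.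
Proof. by rewrite /cpow mulrDl cexpD. Qed.

Lemma cpowM s t z : 0 < s -> 0 < t -> cpow (s * t) z = cpow s z * cpow t z.
Proof. by move=> s0 t0; rewrite /cpow lnM ?posrE// rmorphD mulrDr cexpD. Qed.

Lemma cpow_real t r : 0 < t -> cpow t r%:C = (t `^ r)%:C.
Proof. by move=> t0; rewrite /cpow -rmorphM cexp_real /powR gt_eqF. Qed.

Lemma normc_cpow t z : 0 < t -> normc (cpow t z) = t `^ Re z.
Proof.
move=> t0; rewrite /cpow normc_cexp ReM/= mulr0 subr0.
by rewrite /powR gt_eqF.
Qed.

Lemma cpow_neq0 t z : cpow t z != 0.
Proof. by rewrite -normc_eq0 normc_cexp gt_eqF// expR_gt0. Qed.

Lemma cpow_nat t n : 0 < t -> cpow t n%:R = (t ^+ n)%:C.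
Proof.
by move=> t0; rewrite -(rmorph_nat (real_complex R)) cpow_real// powR_mulrn ?ltW.
Qed.

Lemma cpow1l z : cpow 1 z = 1 :> R[i].
Proof. by rewrite /cpow ln1 mulr0 cexp_real expR0. Qed.

Lemma real_complexV r : (r^-1)%:C = (r%:C)^-1 :> R[i].
Proof. exact: fmorphV. Qed.

End complex_basics.

(** * Measurability and integration of complex-valued functions *)

Section complex_integral.
Context {R : realType}.
Notation mu := (@lebesgue_measure R).
Implicit Types (f g : R -> R[i]) (D : set R).

(** The domain is an arbitrary measurable type because Fubini's theorem uses this notion on
    [R * R]. *)
Definition cmeasurable d (T : measurableType d) (D : set T) (f : T -> R[i]) :=
  measurable_fun D (fun t => Re (f t)) /\ measurable_fun D (fun t => Im (f t)).

Lemma cmeasurableM d (T : measurableType d) (D : set T) (f g : T -> R[i]) :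
  cmeasurable D f -> cmeasurable D g -> cmeasurable D (fun t => f t * g t).
Proof.
move=> [f1 f2] [g1 g2]; split.
  rewrite [X in measurable_fun _ X](_ : _ =
    (fun t => Re (f t) * Re (g t) - Im (f t) * Im (g t))); last first.
    by apply/funext => t; rewrite [LHS]ReM.
  by apply: measurable_funB; apply: measurable_funM.
rewrite [X in measurable_fun _ X](_ : _ =
  (fun t => Re (f t) * Im (g t) + Im (f t) * Re (g t))); last first.
  by apply/funext => t; rewrite [LHS]ImM.
by apply: measurable_funD; apply: measurable_funM.
Qed.

Lemma cmeasurable_cst d (T : measurableType d) (D : set T) (k : R[i]) :
  cmeasurable D (fun=> k).
Proof. by split; exact: measurable_cst. Qed.

Lemma cmeasurable_real d (T : measurableType d) (D : set T) (f : T -> R) :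
  measurable_fun D f -> cmeasurable D (fun t => (f t)%:C).
Proof. by move=> mf; split => //=; exact: measurable_cst. Qed.

Lemma cmeasurable_comp d (T : measurableType d) (D : set T) f (h : T -> R) :
  cmeasurable setT f -> measurable_fun D h -> cmeasurable D (fun t => f (h t)).
Proof.
move=> [f1 f2] mh; split.
- exact: (@measurableT_comp _ _ _ _ _ _ (fun t => Re (f t)) _ h f1 mh).
- exact: (@measurableT_comp _ _ _ _ _ _ (fun t => Im (f t)) _ h f2 mh).
Qed.

Lemma cmeasurableS d (T : measurableType d) (D E : set T) (f : T -> R[i]) :
  measurable E -> D `<=` E -> cmeasurable E f -> cmeasurable D f.
Proof. by move=> mE DE [? ?]; split; exact: measurable_funS DE _. Qed.

Lemma cmeasurable_cpow (z : R[i]) : cmeasurable setT (fun t : R => cpow t z).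
Proof.
have mc (r : R) : measurable_fun setT (fun t : R => r * ln t).
  by apply: measurable_funM => //; exact: measurable_ln.
have mE : measurable_fun setT (fun t : R => expR (Re z * ln t)).
  exact: measurableT_comp (mc _).
apply: cmeasurableM; first apply: cmeasurable_real.
  under eq_fun do rewrite ReM/= mulr0 subr0.
  exact: mE.
split => /=; under eq_fun do rewrite ImM/= mulr0 add0r.
- apply: (measurableT_comp (f := cos)) (mc _).
  by apply: continuous_measurable_fun; exact: continuous_cos.
- apply: (measurableT_comp (f := sin)) (mc _).
  by apply: continuous_measurable_fun; exact: continuous_sin.
Qed.

Lemma eq_cintegral D f g : (forall t, D t -> f t = g t) ->
  cintegral D f = cintegral D g.
Proof.
move=> fg; rewrite /cintegral; congr (_ +i* _);
  by apply: eq_Rintegral => t; rewrite inE => /fg ->.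
Qed.

Lemma eq_cintegrable D f g : measurable D -> (forall t, D t -> f t = g t) ->
  cintegrable D f -> cintegrable D g.
Proof.
move=> mD fg [i1 i2]; split.
- by apply: eq_integrable i1 => // t; rewrite inE => /fg /= ->.
- by apply: eq_integrable i2 => // t; rewrite inE => /fg /= ->.
Qed.

Lemma cintegrable_cmeasurable D f : cintegrable D f -> cmeasurable D f.
Proof.
by move=> [/measurable_int/measurable_EFinP ? /measurable_int/measurable_EFinP].
Qed.

Lemma cintegrable_dominated D f (h : R -> R) : measurable D -> cmeasurable D f ->
  (forall t, D t -> normc (f t) <= h t) -> mu.-integrable D (EFin \o h) ->
  cintegrable D f.
Proof.
move=> mD [m1 m2] fh ih; split.
- apply: le_integrable ih => //; first exact/measurable_EFinP.
  move=> t Dt; rewrite lee_fin (le_trans (normc_Re_le _))//.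
  by rewrite (le_trans (fh _ Dt))// ler_norm.
- apply: le_integrable ih => //; first exact/measurable_EFinP.
  move=> t Dt; rewrite lee_fin (le_trans (normc_Im_le _))//.
  by rewrite (le_trans (fh _ Dt))// ler_norm.
Qed.

Lemma cintegrable_normc D f : measurable D -> cintegrable D f ->
  mu.-integrable D (EFin \o (fun t => normc (f t))).
Proof.
move=> mD [i1 i2].
have mf := cintegrable_cmeasurable (conj i1 i2).
have i : mu.-integrable D ((fun t => `|Re (f t)|%:E) \+ (fun t => `|Im (f t)|%:E))%E.
  by apply: integrableD => //; exact: integrable_norm.
apply: le_integrable i => //.
  apply/measurable_EFinP; rewrite [X in measurable_fun _ X](_ : _ =
    (fun t => Num.sqrt (Re (f t) ^+ 2 + Im (f t) ^+ 2))); last first.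
    by apply/funext => t; case: (f t).
  apply: measurableT_comp.
    by apply: continuous_measurable_fun; exact: sqrt_continuous.
  by apply: measurable_funD; apply: measurable_funX; case: mf.
move=> t Dt /=; rewrite lee_fin ger0_norm ?normc_ge0//.
by rewrite (le_trans (normc_le_ReIm _))// ler_norm.
Qed.

Lemma cintegralZ D (k : R[i]) f : measurable D -> cintegrable D f ->
  cintegral D (fun t => k * f t) = k * cintegral D f.
Proof.
move=> mD [i1 i2]; case: k => a b.
have iZ (r : R) (h : R -> R) : mu.-integrable D (EFin \o h) ->
    mu.-integrable D (EFin \o (fun t => r * h t)).
  by move=> ih; rewrite (_ : _ \o _ = (fun t => r%:E * (h t)%:E)%E)//;
     exact: integrableZl.
rewrite /cintegral.
under eq_Rintegral do rewrite ReM/=.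
under [X in _ +i* X]eq_Rintegral do rewrite ImM/=.
by rewrite RintegralB ?RintegralD ?RintegralZl//; exact: iZ.
Qed.

Lemma cintegrableZ D (k : R[i]) f : measurable D -> cintegrable D f ->
  cintegrable D (fun t => k * f t).
Proof.
move=> mD i.
apply: (@cintegrable_dominated D _ (fun t => normc k * normc (f t))) => //.
- by apply: cmeasurableM; [exact: cmeasurable_cst|exact: cintegrable_cmeasurable].
- by move=> t Dt; rewrite normcM.
- rewrite (_ : _ \o _ = (fun t => (normc k)%:E * (normc (f t))%:E)%E)//.
  by apply: integrableZl => //; exact: cintegrable_normc.
Qed.

Lemma cintegralZr D (k : R[i]) f : measurable D -> cintegrable D f ->
  cintegral D (fun t => f t * k) = cintegral D f * k.
Proof.
move=> mD fi; rewrite mulrC -cintegralZ//.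
by apply: eq_cintegral => t _; rewrite mulrC.
Qed.

Lemma cintegralD D f g : measurable D -> cintegrable D f -> cintegrable D g ->
  cintegral D (fun t => f t + g t) = cintegral D f + cintegral D g.
Proof.
move=> mD [f1 f2] [g1 g2]; rewrite /cintegral.
under eq_Rintegral do rewrite ReD.
under [X in _ +i* X]eq_Rintegral do rewrite ImD.
by rewrite !RintegralD.
Qed.

Lemma cintegrableD D f g : measurable D -> cintegrable D f -> cintegrable D g ->
  cintegrable D (fun t => f t + g t).
Proof.
move=> mD [f1 f2] [g1 g2]; split.
- rewrite (_ : _ \o _ = (fun t => (Re (f t))%:E + (Re (g t))%:E)%E).
    exact: integrableD.
  by apply/funext => t /=; rewrite ReD.
- rewrite (_ : _ \o _ = (fun t => (Im (f t))%:E + (Im (g t))%:E)%E).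
    exact: integrableD.
  by apply/funext => t /=; rewrite ImD.
Qed.

Lemma cintegral_real D (h : R -> R) :
  cintegral D (fun t => (h t)%:C) = (\int[mu]_(t in D) h t)%:C.
Proof. 
by rewrite /cintegral/= {2}/Rintegral integral0. Qed.

(** Turns the domain into a factor of the integrand, since the affine substitution and Fubini's
    theorem are stated over the whole line. *)
Lemma cintegral_mkcond D f :
  cintegral D f = cintegral setT (fun t => (\1_D t)%:C * f t).
Proof.
rewrite /cintegral Rintegral_mkcond [X in _ +i* X]Rintegral_mkcond.
congr (_ +i* _); apply: eq_Rintegral => t _; rewrite patchE indicE.
  by rewrite ReM/=; case: ifP => _; rewrite ?mul1r ?mul0r ?subr0.
by rewrite ImM/=; case: ifP => _; rewrite ?mul1r ?mul0r ?addr0.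
Qed.

Lemma cintegrable_mkcond D f : measurable D ->
  cintegrable D f <-> cintegrable setT (fun t => (\1_D t)%:C * f t).
Proof.
move=> mD.
have E (P : R[i] -> R) : (forall (r : R) z, P (r%:C * z) = r * P z) ->
  mu.-integrable D (EFin \o (fun t => P (f t))) <->
  mu.-integrable setT (EFin \o (fun t => P ((\1_D t)%:C * f t))).
  move=> PZ; have -> : EFin \o (fun t => P ((\1_D t)%:C * f t)) =
     (EFin \o (fun t => P (f t))) \_ D.
    apply/funext => t; rewrite /= PZ patchE indicE.
    by case: ifP => _; rewrite ?mul1r ?mul0r.
  exact: integrable_mkcond.
have Er (r : R) z : Re (r%:C * z) = r * Re z by rewrite ReM/= mul0r subr0.
have Ei (r : R) z : Im (r%:C * z) = r * Im z by rewrite ImM/= mul0r addr0.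
rewrite /cintegrable; split => -[i1 i2]; split.
- exact: (E _ Er).1.
- exact: (E _ Ei).1.
- exact: (E _ Er).2.
- exact: (E _ Ei).2.
Qed.

End complex_integral.

(** * Affine substitution in the Lebesgue integral *)

Section affine_substitution.
Context {R : realType}.
Notation mu := (@lebesgue_measure R).
Variables (k b : R) (k_gt0 : 0 < k).
Let phi (x : measurableTypeR R) : measurableTypeR R := k * x + b.

Let mphi : measurable_fun setT phi.
Proof. by apply: measurable_funD => //; exact: measurable_funM. Qed.

Let image_measure : {measure set (measurableTypeR R) -> \bar R}.
Proof. by refine (pushforward mu phi); exact: mphi. Defined.

(** The preimage of []x, y]] under [phi] has length [(y - x) / k], and Lebesgue measure is
    determined by its values on such intervals. *)
Lemma lebesgue_measure_affine (A : set R) : measurable A ->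
  mu A = mscale (NngNum (ltW k_gt0)) image_measure A.
Proof.
move=> mA; apply: lebesgue_measure_unique => //= _ [[x y]] _ <-.
rewrite /mscale/= /pushforward.
rewrite (_ : phi @^-1` _ = `](x - b) / k, (y - b) / k]%classic); last first.
  apply/seteqP; split => t /=; rewrite !in_itv/= ltr_pdivrMr// ler_pdivlMr//.
    by rewrite ltrBlDr lerBrDr mulrC.
  by rewrite ltrBlDr lerBrDr mulrC.
rewrite !lebesgue_measure_itv/= !lte_fin ltr_pM2r ?invr_gt0// ltrD2r.
case: ifPn => _; last by rewrite mule0.
by rewrite -!EFinB -EFinM; congr (_%:E); field; rewrite gt_eqF.
Qed.

Lemma ge0_integral_affine (f : R -> \bar R) :
  measurable_fun setT f -> (forall t, 0 <= f t)%E ->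
  (\int[mu]_t f (k * t + b)%R = (k^-1)%:E * \int[mu]_t f t)%E.
Proof.
move=> mf f0.
have -> : (\int[mu]_t f t = k%:E * \int[mu]_t f (k * t + b)%R)%E.
  transitivity (\int[mscale (NngNum (ltW k_gt0)) image_measure]_t f t)%E.
    by apply: eq_measure_integral => A mA _; exact: lebesgue_measure_affine.
  by rewrite ge0_integral_mscale//= ge0_integral_pushforward.
by rewrite muleA -EFinM mulVf ?gt_eqF// mul1e.
Qed.

Lemma integrable_affine (f : R -> R) : mu.-integrable setT (EFin \o f) ->
  mu.-integrable setT (EFin \o (fun t => f (k * t + b))).
Proof.
move=> /integrableP[mf fi]; apply/integrableP; split.
  exact: (@measurableT_comp _ _ _ _ _ _ (EFin \o f) _ phi mf mphi).
have mnf : measurable_fun setT (abse \o (EFin \o f)).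
  exact: measurableT_comp.
rewrite [ltLHS](_ : _ = (k^-1)%:E * \int[mu]_t `|(EFin \o f) t|)%E.
  by rewrite lte_mul_pinfty// lee_fin invr_ge0 ltW.
by rewrite -(@ge0_integral_affine (fun t => `|(EFin \o f) t|%E)).
Qed.

Lemma Rintegral_affine (f : R -> R) : mu.-integrable setT (EFin \o f) ->
  \int[mu]_t f (k * t + b) = k^-1 * \int[mu]_t f t.
Proof.
move=> fi; have [mf _] := integrableP _ _ _ fi.
have fi' := integrable_affine fi.
rewrite /Rintegral [in LHS]integralE [in RHS]integralE.
have P : (\int[mu]_t (EFin \o (fun t => f (k * t + b)%R))^\+ t =
    (k^-1)%:E * \int[mu]_t (EFin \o f)^\+ t)%E.
  rewrite -(ge0_integral_affine (measurable_funepos mf)).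
    by apply: eq_integral => t _; rewrite !funeposE.
  by move=> t; exact: funepos_ge0.
have N : (\int[mu]_t (EFin \o (fun t => f (k * t + b)%R))^\- t =
    (k^-1)%:E * \int[mu]_t (EFin \o f)^\- t)%E.
  rewrite -(ge0_integral_affine (measurable_funeneg mf)).
    by apply: eq_integral => t _; rewrite !funenegE.
  by move=> t; exact: funeneg_ge0.
have fp := integrable_pos_fin_num measurableT fi.
have fn := integrable_neg_fin_num measurableT fi.
rewrite [in LHS]P [in LHS]N -muleBr//; last by rewrite fin_num_adde_defl// fin_numN.
by rewrite fineM// fin_numB fp fn.
Qed.

Lemma cintegrable_affine (f : R -> R[i]) : cintegrable setT f ->
  cintegrable setT (fun t => f (k * t + b)).
Proof. by move=> [i1 i2]; split; [exact: integrable_affine i1|exact: integrable_affine i2]. Qed.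

Lemma cintegral_affine (f : R -> R[i]) : cintegrable setT f ->
  cintegral setT (fun t => f (k * t + b)) = (k^-1)%:C * cintegral setT f.
Proof.
move=> [i1 i2]; rewrite /cintegral (Rintegral_affine i1) (Rintegral_affine i2).
by apply/eqP; rewrite eq_complex ReM ImM /= !mul0r subr0 addr0 !eqxx.
Qed.

End affine_substitution.

(** * Fubini's theorem for complex-valued functions *)

Section complex_fubini.
Context {R : realType}.
Notation mu := (@lebesgue_measure R).

(** The real theorem is applied to the real and imaginary parts, both dominated by the modulus.
    Integrability is asked of every slice because the inner integrals are real numbers obtained
    through [fine], which sends an infinite value to 0. *)
Lemma cintegral_fubini (F : R * R -> R[i]) : cmeasurable setT F ->
  (forall x, cintegrable setT (fun y => F (x, y))) ->
  (forall y, cintegrable setT (fun x => F (x, y))) ->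
  (\int[mu]_x \int[mu]_y (normc (F (x, y)))%:E < +oo)%E ->
  cintegral setT (fun x => cintegral setT (fun y => F (x, y))) =
  cintegral setT (fun y => cintegral setT (fun x => F (x, y))).
Proof.
move=> mF iFx iFy Foo.
have mnF : measurable_fun setT (fun z => (normc (F z))%:E).
  apply/measurable_EFinP; rewrite [X in measurable_fun _ X](_ : _ =
    (fun t => Num.sqrt (Re (F t) ^+ 2 + Im (F t) ^+ 2))); last first.
    by apply/funext => t; case: (F t).
  apply: measurableT_comp.
    by apply: continuous_measurable_fun; exact: sqrt_continuous.
  by apply: measurable_funD; apply: measurable_funX; case: mF.
have key (P : R[i] -> R) : measurable_fun setT (fun z => P (F z)) ->
   (forall z, `|P z| <= normc z) ->
   (forall x, mu.-integrable setT (EFin \o (fun y => P (F (x, y))))) ->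
   (forall y, mu.-integrable setT (EFin \o (fun x => P (F (x, y))))) ->
   \int[mu]_x \int[mu]_y P (F (x, y)) = \int[mu]_y \int[mu]_x P (F (x, y)).
  move=> mP Ple ix iy.
  have iP : (mu \x mu)%E.-integrable setT (fun z => (P (F z))%:E).
    have i : (mu \x mu)%E.-integrable setT (fun z => (normc (F z))%:E).
      apply/integrable12ltyP; first exact: mnF.
      apply: le_lt_trans Foo.
      by under eq_integral do under eq_integral do rewrite /= ger0_norm ?normc_ge0//.
    apply: le_integrable i => //; first exact/measurable_EFinP.
    by move=> z _; rewrite lee_fin [leRHS]ger0_norm// normc_ge0.
  rewrite /Rintegral.
  have L x : (fine (\int[mu]_y (P (F (x, y)))%:E))%:E = (\int[mu]_y (P (F (x, y)))%:E)%E.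
    by rewrite fineK// integrable_fin_num//; exact: ix.
  have L' y : (fine (\int[mu]_x (P (F (x, y)))%:E))%:E = (\int[mu]_x (P (F (x, y)))%:E)%E.
    by rewrite fineK// integrable_fin_num//; exact: iy.
  under eq_integral do rewrite L.
  under [in RHS]eq_integral do rewrite L'.
  by rewrite (Fubini iP).
have [m1 m2] := mF.
have kR := key _ m1 (@normc_Re_le R) (fun x => (iFx x).1) (fun y => (iFy y).1).
have kI := key _ m2 (@normc_Im_le R) (fun x => (iFx x).2) (fun y => (iFy y).2).
exact: (f_equal2 (@Complex R) kR kI).
Qed.

End complex_fubini.

(** * The gamma kernel: integrability, and positivity of Gamma on the positive reals *)

Section gamma_kernel.
Context {R : realType}.
Notation mu := (@lebesgue_measure R).

Lemma itv0y_gt0 (t : R) : `]0, +oo[%classic t -> 0 < t.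
Proof. by rewrite /= in_itv/= andbT. Qed.

Lemma continuous_powR_gt0 (x t : R) : 0 < t -> {for t, continuous (fun s => s `^ x)}.
Proof.
move=> t0; apply: differentiable_continuous; apply/derivable1_diffP.
by apply: derivable_powR; rewrite in_itv/= t0.
Qed.

Lemma integral_powR (x a b : R) : 0 < x -> 0 < a < b ->
  (\int[mu]_(t in `[a, b]) (t `^ (x - 1))%:E = (x^-1 * b `^ x - x^-1 * a `^ x)%:E)%E.
Proof.
move=> x0 /andP[a0 ab].
have pos t : t \in `[a, b] -> 0 < t.
  by rewrite in_itv/= => /andP[/(lt_le_trans a0)].
have dF t : 0 < t -> derivable (fun s => x^-1 * s `^ x) t 1.
  move=> t0; apply: derivableM => //; apply: derivable_powR.
  by rewrite in_itv/= t0.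
have cF t : 0 < t -> {for t, continuous (fun s => x^-1 * s `^ x)}.
  by move=> t0; apply: cvgM; [exact: cvg_cst|exact: continuous_powR_gt0].
rewrite EFinB; apply: (@continuous_FTC2 _ _ (fun s => x^-1 * s `^ x)) => //.
- apply: continuous_in_subspaceT => t; rewrite inE/= => /pos.
  exact: continuous_powR_gt0.
- split.
  + by move=> t /subset_itv_oo_cc /pos /dF.
  + by apply: cvg_at_right_filter; exact: cF.
  + by apply: cvg_at_left_filter; apply: cF; exact: lt_trans ab.
- move=> t /subset_itv_oo_cc /pos t0.
  rewrite derive1E deriveM//; last by apply: derivable_powR; rewrite in_itv/= t0.
  rewrite derive_cst scaler0 addr0 -derive1E powR_derive1 ?in_itv/= ?t0//.
  by rewrite /GRing.scale/= mulrA mulVf ?gt_eqF// mul1r.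
Qed.

(** Monotone convergence: the segments [[b / (i + 2), b]] exhaust []0, b]], and on each of them the
    integral is at most [b^x / x]. *)
Lemma integrable_powR (x b : R) : 0 < x -> 0 < b ->
  mu.-integrable `]0, b] (EFin \o (fun t => t `^ (x - 1))).
Proof.
move=> x0 b0.
have mp : measurable_fun [set: R] (fun t : R => (t `^ (x - 1))%:E).
  by apply/measurable_EFinP; exact: measurable_powR.
apply/integrableP; split; first exact: measurable_funTS.
(* With [i.+2] instead of [i.+1] the left endpoint is strictly below [b] already for [i = 0], as
   [integral_powR] requires. *)
pose F (i : nat) : set R := `[b / i.+2%:R, b]%classic.
have FE : `]0, b]%classic = \bigcup_i F i.
  apply/seteqP; split => t.
    rewrite /= in_itv/= => /andP[t0 tb].
    exists (Num.truncn (b / t)) => //; rewrite /F/= in_itv/= tb andbT.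
    rewrite ler_pdivrMr// -ler_pdivrMl// mulrC ltW//.
    apply: (lt_le_trans (truncnS_gt _)).
    by rewrite ler_nat.
  move=> [i _]; rewrite /F/= !in_itv/= => /andP[bt ->]; rewrite andbT.
  by apply: lt_le_trans bt; rewrite divr_gt0.
have nF : nondecreasing_seq F.
  move=> i j ij; apply/subsetPset => t; rewrite /F/= !in_itv/= => /andP[+ ->].
  rewrite andbT; apply: le_trans.
  by rewrite ler_pM2l// lef_pV2 ?posrE// ler_nat !ltnS.
under eq_integral do rewrite /= ger0_norm ?powR_ge0//.
rewrite FE; have cF : (\int[mu]_(t in F i) (t `^ (x - 1))%:E @[i --> \oo] -->
    \int[mu]_(t in \bigcup_i F i) (t `^ (x - 1))%:E)%E.
  apply: ge0_nondecreasing_set_cvg_integral => //.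
  - by move=> i; exact: measurable_itv.
  - by move=> i; exact: measurable_funTS.
  - by move=> i t _; rewrite lee_fin powR_ge0.
rewrite -(cvg_lim _ cF)//; apply: (@le_lt_trans _ _ (x^-1 * b `^ x)%:E); last exact: ltry.
apply: lime_le; first by apply/cvg_ex; eexists; exact: cF.
apply: nearW => i; rewrite integral_powR//; last first.
  rewrite divr_gt0//= ltr_pdivrMr// ltr_pMr// ltr1n//.
by rewrite lee_fin gerBl// mulr_ge0 ?invr_ge0 ?powR_ge0// ltW.
Qed.

(** The inequality [ln u < u] at [u = t / (2 x)] gives [x ln t <= t / 2 + x ln (2 x)], so that half
    of the exponential decay absorbs the power. *)
Lemma powR_expRN_le (x t : R) : 0 < x -> 1 <= t ->
  t `^ (x - 1) * expR (- t) <= expR (x * ln (2 * x)) * expR (- (2^-1 * t)).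
Proof.
move=> x0 t1; have t0 : 0 < t by exact: lt_le_trans t1.
rewrite /powR gt_eqF// -!expRD ler_expR.
have lt0 : 0 <= ln t by exact: ln_ge0.
have : ln (t / (2 * x)) < t / (2 * x) by apply: ln_sublinear; rewrite divr_gt0// mulr_gt0.
rewrite ln_div ?posrE ?mulr_gt0// ltrBlDr => h.
have : x * ln t <= x * (t / (2 * x) + ln (2 * x)) by rewrite ler_pM2l// ltW.
rewrite mulrDr (_ : x * (t / _) = 2^-1 * t); last first.
  by field; rewrite gt_eqF.
by lra.
Qed.

Lemma integrable_gamma_kernel (x : R) : 0 < x ->
  mu.-integrable `]0, +oo[ (EFin \o (fun t => t `^ (x - 1) * expR (- t))).
Proof.
move=> x0; pose K := expR (x * ln (2 * x)).
pose h1 : R -> \bar R := (EFin \o (fun t => t `^ (x - 1))) \_ `]0, 1].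
(* The exponential density of rate 1/2 carries a factor 1/2, which the coefficient 2 cancels: for
   [t >= 0], [h2] is the bound of [powR_expRN_le]. It serves beyond 1, and [h1] serves on []0,
   1]]. *)
pose h2 (t : R) : \bar R := ((2 * K)%:E * (exponential_pdf (2^-1 : R) t)%:E)%E.
have i1 : mu.-integrable setT h1.
  by apply/(integrable_mkcond _ _).1 => //; exact: integrable_powR.
have i2 : mu.-integrable setT h2.
  apply: integrableZl => //; apply: integrable_exponential_pdf.
  by rewrite invr_gt0.
have i : mu.-integrable `]0, +oo[ (h1 \+ h2)%E.
  by apply: integrableS (integrableD measurableT i1 i2).
apply: le_integrable i => //.
  apply/measurable_EFinP/measurable_funTS; apply: measurable_funM.
    exact: measurable_powR.
  apply: (measurableT_comp (f := expR)) => //.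
move=> t /=; rewrite in_itv/= andbT => t0.
rewrite /h2 (exponential_pdfE _ (ltW t0)).
rewrite ger0_norm ?mulr_ge0 ?powR_ge0 ?expR_ge0//.
rewrite /h1 /h2 patchE; case: ifPn => [|].
  rewrite inE/= in_itv/= => /andP[_ t1].
  rewrite -?EFinM -?EFinD lee_fin [leRHS]ger0_norm.
    rewrite -[leLHS]addr0 lerD//.
      by rewrite ler_piMr ?powR_ge0// -expR0 ler_expR oppr_le0 ltW.
    by rewrite !mulr_ge0 ?expR_ge0 ?invr_ge0.
  by rewrite addr_ge0 ?powR_ge0// !mulr_ge0 ?expR_ge0 ?invr_ge0.
rewrite notin_setE/= in_itv/= t0/= => /negP; rewrite -ltNge => t1.
rewrite add0r lee_fin [leRHS]ger0_norm; last first.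
  by rewrite !mulr_ge0 ?expR_ge0 ?invr_ge0.
apply: (le_trans (powR_expRN_le x0 (ltW t1))).
by rewrite mulNr le_eqVlt; apply/orP; left; apply/eqP; rewrite -/K; field.
Qed.

Definition gamma_kernel (z : R[i]) (t : R) : R[i] := cpow t (z - 1) * (expR (- t))%:C.

Lemma cmeasurable_gamma_kernel z : cmeasurable setT (gamma_kernel z).
Proof.
apply: cmeasurableM; first exact: cmeasurable_cpow.
apply: cmeasurable_real; apply: (measurableT_comp (f := expR)) => //.
Qed.

Lemma normc_gamma_kernel z t : 0 < t ->
  normc (gamma_kernel z t) = t `^ (Re z - 1) * expR (- t).
Proof.
move=> t0; rewrite normcM normc_cpow// normc_real ger0_norm ?expR_ge0//.
by rewrite ReD ReN.
Qed.

Lemma cintegrable_gamma_kernel z : 0 < Re z ->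
  cintegrable `]0, +oo[ (gamma_kernel z).
Proof.
move=> z0; apply: cintegrable_dominated (integrable_gamma_kernel z0) => //.
- by apply: cmeasurableS (cmeasurable_gamma_kernel z).
- by move=> t /itv0y_gt0 t0; rewrite normc_gamma_kernel.
Qed.

Lemma GammaE (z : R[i]) : 0 < Re z ->
  Gamma z = cintegral `]0, +oo[ (gamma_kernel z).
Proof. by move=> z0; rewrite /Gamma z0. Qed.

Lemma Gamma_real (x : R) : 0 < x ->
  Gamma x%:C = (\int[mu]_(t in `]0, +oo[) (t `^ (x - 1) * expR (- t)))%:C.
Proof.
move=> x0; rewrite GammaE// -cintegral_real; apply: eq_cintegral => t /itv0y_gt0 t0;
 rewrite /gamma_kernel rmorphM.
by rewrite -[1]/(1%:C) -rmorphB cpow_real.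
Qed.

(** The kernel is nonnegative, and on [[1, 2]] it is at least the constant [m], because there
    [|(x - 1) ln t| <= 2 |x - 1|] and [t <= 2]. *)
Lemma Gamma_real_gt0 (x : R) : 0 < x -> 0 < Re (Gamma x%:C).
Proof.
move=> x0; rewrite Gamma_real//=.
have i := integrable_gamma_kernel x0.
pose m := expR (- (2 * `|x - 1|) - 2).
have s12 : `[1, 2]%classic `<=` (`]0, +oo[%classic : set R).
  by move=> t /=; rewrite !in_itv/= andbT => /andP[t1 _]; exact: lt_le_trans t1.
apply: (@lt_le_trans _ _ (\int[mu]_(t in `[1, 2]) m)).
  rewrite Rintegral_cst//= lebesgue_measure_itv/= lte_fin ltr1n.
  by rewrite -EFinB/= mulr_gt0 ?expR_gt0//; lra.
apply: (@le_trans _ _ (\int[mu]_(t in `[1, 2]) (t `^ (x - 1) * expR (- t)))).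
  apply: le_Rintegral => //.
  - apply/integrableP; split => //; first exact: measurable_cst.
    by rewrite integral_cst//= lebesgue_measure_itv/= lte_fin ltr1n -EFinB -EFinM ltry.
  - exact: integrableS i.
  - move=> t /=; rewrite in_itv/= => /andP[t1 t2].
    have t0 : 0 < t by exact: lt_le_trans t1.
    rewrite /powR gt_eqF// -expRD ler_expR.
    have : `|(x - 1) * ln t| <= 2 * `|x - 1|.
      rewrite normrM mulrC ler_wpM2r//.
      rewrite ger0_norm ?ln_ge0// ltW// (lt_le_trans (ln_sublinear t0))//.
    rewrite ler_norml => /andP[h _].
    by lra.
rewrite /Rintegral fine_le//.
- by apply: integrable_fin_num => //; exact: integrableS i.
- exact: integrable_fin_num.
- apply: ge0_subset_integral => //.
  + by case/integrableP: i.
  + by move=> t _; rewrite lee_fin mulr_ge0 ?powR_ge0 ?expR_ge0.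
Qed.

End gamma_kernel.

(** * Euler's beta integral and its relation to Gamma *)

Section beta_integral.
Context {R : realType}.
Notation mu := (@lebesgue_measure R).
Implicit Types (p q z : R[i]) (X t : R).

Definition beta_kernel p q X t : R[i] := cpow t (p - 1) * cpow (1 - t / X) (q - 1).

Definition beta_integral p q : R[i] := cintegral `]0, 1[ (beta_kernel p q 1).

Lemma cmeasurable_beta_kernel p q X : cmeasurable setT (beta_kernel p q X).
Proof.
apply: cmeasurableM; first exact: cmeasurable_cpow.
apply: (cmeasurable_comp (cmeasurable_cpow _)).
by apply: measurable_funB => //; exact: measurable_funM.
Qed.

(** For [Re q >= 1] the factor [(1 - t / X)^(q - 1)] has modulus at most 1, so that only the
    endpoint 0 can be singular. The value [q = 1 + eta / (1 - alpha)] of the application lies in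
    this range. *)
Lemma normc_beta_kernel_le p q X t : 1 <= Re q -> 0 < t < X ->
  normc (beta_kernel p q X t) <= t `^ (Re p - 1).
Proof.
move=> q1 /andP[t0 tX]; have X0 := lt_trans t0 tX.
have h1 : 0 < 1 - t / X by rewrite subr_gt0 ltr_pdivrMr// mul1r.
have h2 : 1 - t / X <= 1 by rewrite gerBl// divr_ge0// ltW.
rewrite normcM !normc_cpow// !ReD !ReN/=.
rewrite ler_piMr ?powR_ge0// /powR gt_eqF// -[leRHS]expR0 ler_expR.
by rewrite mulr_ge0_le0 ?subr_ge0// ln_le0.
Qed.

Lemma cintegrable_beta_kernel p q X : 0 < X -> 0 < Re p -> 1 <= Re q ->
  cintegrable `]0, X[ (beta_kernel p q X).
Proof.
move=> X0 p0 q1; have i := integrable_powR p0 X0.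
apply: (cintegrable_dominated (h := fun t => t `^ (Re p - 1))) => //.
- exact: cmeasurableS (cmeasurable_beta_kernel _ _ _).
- by move=> t; rewrite /= in_itv/= => tX; exact: normc_beta_kernel_le.
- by apply: integrableS i => //; apply: subset_itvl; rewrite bnd_simp.
Qed.

(** Substitution [t = X s]: the Jacobian [X] and the factor [X^(p - 1)] combine into [X^p]. *)
Lemma cintegral_beta_kernel p q X : 0 < X -> 0 < Re p -> 1 <= Re q ->
  cintegral `]0, X[ (beta_kernel p q X) = cpow X p * beta_integral p q.
Proof.
move=> X0 p0 q1.
have iX := (cintegrable_mkcond _ (measurable_itv _)).1 (cintegrable_beta_kernel X0 p0 q1).
rewrite /beta_integral [in LHS]cintegral_mkcond.
have -> : cpow X p = X%:C * cpow X (p - 1).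
  have c1 : cpow X 1 = X%:C := cpow_nat 1 X0.
  by rewrite mulrC -c1 -cpowD subrK.
rewrite -mulrA -cintegralZ//; last exact: cintegrable_beta_kernel.
rewrite [in RHS]cintegral_mkcond.
transitivity (X%:C * (X^-1%:C * cintegral setT
    (fun t => (\1_`]0, X[ t)%:C * beta_kernel p q X t))).
  by rewrite mulrA -rmorphM mulfV ?gt_eqF// mul1r.
congr (_ * _); rewrite -(cintegral_affine 0 X0 iX).
apply: eq_cintegral => t _; rewrite addr0 !indicE !mem_setE !in_itv/=.
rewrite pmulr_rgt0// gtr_pMr//.
have [/andP[t0 t1]|_] := boolP (0 < t < 1); last by rewrite !mul0r.
rewrite !mul1r /beta_kernel cpowM// mulrA divr1.
by rewrite [X in 1 - X]mulrAC mulfV ?gt_eqF// mul1r.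
Qed.

(** At nonpositive arguments [cpow] takes the value 1. Extending the kernel by zero instead confines
    the convolution of two kernels at [w] to []0, w[]. *)
Definition gamma_ext z t : R[i] := (\1_`]0, +oo[ t)%:C * gamma_kernel z t.

Lemma gamma_ext_gt0 z t : 0 < t -> gamma_ext z t = gamma_kernel z t.
Proof. by move=> t0; rewrite /gamma_ext indicE mem_setE in_itv/= t0 mul1r. Qed.

Lemma gamma_ext_le0 z t : t <= 0 -> gamma_ext z t = 0.
Proof. by move=> t0; rewrite /gamma_ext indicE mem_setE in_itv/= ltNge t0 mul0r. Qed.

Lemma cintegrable_gamma_ext z : 0 < Re z -> cintegrable setT (gamma_ext z).
Proof.
by move=> z0; apply/(cintegrable_mkcond _ _).1 => //; exact: cintegrable_gamma_kernel.
Qed.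

Lemma cintegral_gamma_ext z : 0 < Re z -> cintegral setT (gamma_ext z) = Gamma z.
Proof. by move=> z0; rewrite GammaE// [RHS]cintegral_mkcond. Qed.

(** On []0, w[] the exponentials multiply to [e^(-w)], and [w - s = w (1 - s / w)] splits off the
    power [w^(q - 1)]. *)
Lemma gamma_ext_convolution p q w s : 0 < w ->
  gamma_ext p s * gamma_ext q (w - s) =
  (\1_`]0, w[ s)%:C * (cpow w (q - 1) * (expR (- w))%:C * beta_kernel p q w s).
Proof.
move=> w0; rewrite indicE mem_setE in_itv/=.
have [s0|s0] := leP s 0; first by rewrite gamma_ext_le0// !mul0r.
have [sw|sw] /= := ltP s w; last first.
  by rewrite mul0r [gamma_ext q _]gamma_ext_le0 ?mulr0// subr_le0.
rewrite mul1r !gamma_ext_gt0 ?subr_gt0// /gamma_kernel /beta_kernel.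
rewrite (_ : w - s = w * (1 - s / w)); last by field; rewrite gt_eqF.
rewrite cpowM//; last by rewrite subr_gt0 ltr_pdivrMr// mul1r.
rewrite (_ : (expR (- w))%:C = (expR (- s))%:C * (expR (- (w * (1 - s / w))))%:C).
  by ring.
by rewrite -rmorphM -expRD; congr ((expR _)%:C); field; rewrite gt_eqF.
Qed.

Lemma Gamma_beta p q : 0 < Re p -> 1 <= Re q ->
  Gamma p * Gamma q = Gamma (p + q) * beta_integral p q.
Proof.
move=> p0 q1; have q0 : 0 < Re q by exact: lt_le_trans q1.
have ip := cintegrable_gamma_ext p0; have iq := cintegrable_gamma_ext q0.
have iqs s : cintegrable setT (fun w => gamma_ext q (w - s)).
  have := cintegrable_affine (- s) ltr01 iq; apply: eq_cintegrable => // w _.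
  by rewrite mul1r.
pose F (sw : R * R) : R[i] := gamma_ext p sw.1 * gamma_ext q (sw.2 - sw.1).
have mF : cmeasurable setT F.
  apply: cmeasurableM.
    by apply: cmeasurable_comp => //; exact: cintegrable_cmeasurable.
  apply: (@cmeasurable_comp _ _ _ _ (gamma_ext q)).
    exact: cintegrable_cmeasurable.
  by apply: measurable_funB.
have iF1 s : cintegrable setT (fun w => F (s, w)) 
  by apply: (cintegrableZ (gamma_ext p s) _ (iqs s)).
have FE w : 0 < w -> (fun s => F (s, w)) = (fun s => (\1_`]0, w[ s)%:C *
    (cpow w (q - 1) * (expR (- w))%:C * beta_kernel p q w s)).
  by move=> w0; apply/funext => s; exact: gamma_ext_convolution.
(* For [w <= 0] the numbers [s] and [w - s] cannot both be positive. *)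
have F0 w : w <= 0 -> (fun s => F (s, w)) = (fun=> 0).
  move=> w0; apply/funext => s; rewrite /F/=.
  have [s0|s0] := leP s 0; first by rewrite gamma_ext_le0// mul0r.
  by rewrite [gamma_ext q _]gamma_ext_le0 ?mulr0// subr_le0 (le_trans w0)// ltW.
have iF2 w : cintegrable setT (fun s => F (s, w)).
  have [w0|w0] := leP w 0.
    by rewrite F0//; split; exact: integrable0.
  rewrite FE//; apply/(cintegrable_mkcond _ _).1 => //.
  by apply: cintegrableZ => //; exact: cintegrable_beta_kernel.
(* After a translation the inner integral of the modulus no longer depends on [s], so the double
   integral is a product of two finite integrals. *)
have Foo : (\int[mu]_s \int[mu]_w (normc (F (s, w)))%:E < +oo)%E.
  have nq := cintegrable_normc measurableT iq.
  have np := cintegrable_normc measurableT ip.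
  have [mnq _] := integrableP _ _ _ nq.
  have nF s w : normc (F (s, w)) = normc (gamma_ext p s) * normc (gamma_ext q (w - s)).
    exact: normcM.
  have E s : (\int[mu]_w (normc (F (s, w)))%:E =
     (normc (gamma_ext p s))%:E * \int[mu]_w (normc (gamma_ext q w))%:E)%E.
    under eq_integral do rewrite nF EFinM.
    rewrite integralZl; [|by []|exact: cintegrable_normc].
    congr (_ * _)%E.
    under eq_integral do rewrite -[X in gamma_ext q (X - _)]mul1r.
    rewrite (@ge0_integral_affine _ 1 (- s) ltr01 (fun w => (normc (gamma_ext q w))%:E))//.
      by rewrite invr1 mul1e.
    by move=> t; rewrite lee_fin normc_ge0.
  under eq_integral do rewrite E.
  have Cfin := integrable_fin_num measurableT nq.
  rewrite -(fineK Cfin) integralZr//.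
  by rewrite -(fineK (integrable_fin_num measurableT np)) -EFinM ltry.
have <- : cintegral setT (fun s => cintegral setT (fun w => F (s, w))) = Gamma p * Gamma q.
  rewrite -(cintegral_gamma_ext p0) -cintegralZr//.
  apply: eq_cintegral => s _; rewrite /F/= cintegralZ//; congr (_ * _).
  rewrite -(cintegral_gamma_ext q0) -[RHS]mul1r -[X in X * _]/(1%:C) -[X in X%:C * _]invr1.
  rewrite -(cintegral_affine (- s) ltr01 iq).
  by apply: eq_cintegral => w _; rewrite mul1r.
rewrite (cintegral_fubini mF iF1 iF2 Foo).
have pq0 : 0 < Re (p + q) by rewrite ReD addr_gt0.
rewrite -(cintegral_gamma_ext pq0) -cintegralZr//; last exact: cintegrable_gamma_ext.
apply: eq_cintegral => w _; have [w0|w0] := leP w 0.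
  by rewrite F0// gamma_ext_le0// mul0r /cintegral !Rintegral_cst// !mul0r.
rewrite (FE w w0) -cintegral_mkcond.
rewrite cintegralZ; [|exact: measurable_itv|exact: cintegrable_beta_kernel].
(* Rescaling contributes [w^p], and [w^p w^(q - 1) e^(-w)] is the gamma kernel of [p + q] at [w]. *)
rewrite cintegral_beta_kernel// gamma_ext_gt0// /gamma_kernel.
by rewrite -addrA (cpowD w p) mulrA; congr (_ * _); rewrite mulrC mulrA.
Qed.

End beta_integral.

(** * Functional equation of Gamma, and its non-vanishing on the right half-plane *)

Section gamma_function.
Context {R : realType}.
Notation mu := (@lebesgue_measure R).
Implicit Types (w z : R[i]) (s t : R).

Lemma Re_Mreal w (r : R) : Re (w * r%:C) = Re w * r.
Proof. by rewrite ReM/= mulr0 subr0. Qed.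

Lemma Re_cexp w : Re (cexp w) = expR (Re w) * cos (Im w).
Proof. by rewrite /cexp ReM/= mul0r subr0. Qed.

(** The multiplier [w] lets one real computation serve both components of [cpow s z]: [w = 1] gives
    the real part and [w = -i] the imaginary part. *)
Lemma is_derive_Re_cpow w z t : 0 < t ->
  is_derive t 1 (fun s => Re (w * cpow s z)) (Re (w * (z * cpow t (z - 1)))).
Proof.
move=> t0; have dln := is_derive1_ln t0.
rewrite (_ : (fun s => _) = (fun s => expR (Re z * ln s) *
   (Re w * cos (Im z * ln s) - Im w * sin (Im z * ln s)))); last first.
  apply/funext => s; rewrite /cpow /cexp !ReM !ImM/= !mul0r !mulr0 !subr0 !add0r !addr0.
  by ring.
have tN : cpow t (z - 1) = cpow t z * t^-1%:C.
  by rewrite cpowD -[1]/(1%:C) -rmorphN cpow_real// powR_inv1// ltW.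
rewrite tN; apply: is_derive_eq.
rewrite /GRing.scale/= /cpow /cexp !ReM !ImM/= !mul0r !mulr0 !subr0 !add0r !addr0.
by ring.
Qed.

Lemma cintegral_cpow_segment z (a b : R) : 0 < a < b ->
  cintegral `[a, b] (fun t => z * cpow t (z - 1)) = cpow b z - cpow a z.
Proof.
move=> /andP[a0 ab].
have pos t : t \in `[a, b] -> 0 < t by rewrite in_itv/= => /andP[/(lt_le_trans a0)].
have cont w v t : 0 < t -> {for t, continuous (fun s => Re (w * cpow s v))}.
  move=> t0; apply: differentiable_continuous; apply/derivable1_diffP.
  by case: (is_derive_Re_cpow w v t0).
have key w : \int[mu]_(t in `[a, b]) Re (w * (z * cpow t (z - 1))) =
    Re (w * cpow b z) - Re (w * cpow a z).
  rewrite /Rintegral (@continuous_FTC2 _ _ (fun s => Re (w * cpow s z))) //.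
  - apply: continuous_in_subspaceT => t; rewrite inE/= => /pos t0.
    rewrite (_ : (fun s => _) = (fun s => Re (w * z * cpow s (z - 1)))).
      exact: cont.
    by apply/funext => s; rewrite mulrA.
  - split.
    + by move=> t /subset_itv_oo_cc /pos /(is_derive_Re_cpow w z) [].
    + by apply: cvg_at_right_filter; exact: cont.
    + by apply: cvg_at_left_filter; apply: cont; exact: lt_trans ab.
  - move=> t /subset_itv_oo_cc /pos t0; rewrite derive1E.
    by case: (is_derive_Re_cpow w z t0).
have ReE (v : R[i]) : Re v = Re (1 * v) by rewrite mul1r.
have ImE (v : R[i]) : Im v = Re ((0 -i* 1) * v) by rewrite ReM/= mul0r sub0r mulN1r opprK.
apply/eqP; rewrite eq_complex; apply/andP; split; apply/eqP.
- rewrite ReD ReN [Re (cpow b z)]ReE [Re (cpow a z)]ReE -key.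
  by apply: eq_Rintegral => t _; rewrite -ReE.
- rewrite ImD ImN [Im (cpow b z)]ImE [Im (cpow a z)]ImE -key.
  by apply: eq_Rintegral => t _; rewrite -ImE.
Qed.

(* With J the integral over ]0, 1[, the part over ]0, 1/2[ is 2^(-z) J by scaling
   and the part over [1/2, 1[ is (1 - 2^(-z)) / z, so that no limit at the
   singularity 0 is needed. *)
Lemma beta_integral1 z : 0 < Re z -> z * beta_integral z 1 = 1.
Proof.
move=> z0; have h0 : 0 < (2^-1 : R) by rewrite invr_gt0.
have iX := cintegrable_beta_kernel h0 z0 (lexx (Re (1 : R[i]))).
have i1 := cintegrable_beta_kernel ltr01 z0 (lexx (Re (1 : R[i]))).
have E X t : beta_kernel z 1 X t = cpow t (z - 1).
  by rewrite /beta_kernel subrr /cpow mul0r cexp_real expR0 mulr1.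
have m12 : measurable (`[2^-1, 1[%classic : set R) by exact: measurable_itv.
have i2 : cintegrable `[2^-1, 1[ (beta_kernel z 1 1).
  have sub : `[2^-1, 1[%classic `<=` (`]0, 1[%classic : set R).
    by apply: subset_itvr; rewrite bnd_simp.
  by case: i1 => iR iI; split; [exact: integrableS iR|exact: integrableS iI].
have split12 : beta_integral z 1 = cintegral `]0, 2^-1[ (beta_kernel z 1 2^-1)
    + cintegral `[2^-1, 1[ (beta_kernel z 1 1).
  rewrite /beta_integral !(cintegral_mkcond `]0, _[) (cintegral_mkcond `[_, _[).
  rewrite -cintegralD//; last 2 first.
  - exact: (cintegrable_mkcond _ (measurable_itv _)).1 iX.
  - exact: (cintegrable_mkcond _ m12).1 i2.
  apply: eq_cintegral => t _; rewrite !E -mulrDl -rmorphD; congr (_%:C * _).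
  rewrite !indicE !mem_setE !in_itv/=.
  have [t0|t0] /= := ltP 0 t; last first.
    by rewrite (leNgt 2^-1) (le_lt_trans t0 h0) addr0.
  have [t1|t1] /= := ltP t 2^-1; last by rewrite add0r.
  by rewrite addr0 (lt_trans t1)// invf_lt1// ltr1n.
have half : z * cintegral `[2^-1, 1[ (beta_kernel z 1 1) = 1 - cpow 2^-1 z.
  rewrite -[X in _ = X - _](cpow1l z) -cintegral_cpow_segment; last first.
    by rewrite h0 invf_lt1// ltr1n.
  rewrite -cintegralZ//.
  have [iR iI] := cintegrableZ z m12 i2.
  rewrite /cintegral; congr (_ +i* _); rewrite Rintegral_itv_bndo_bndc//;
    by apply: eq_Rintegral => t _; rewrite E.
have := split12; rewrite cintegral_beta_kernel// => /(congr1 (fun u => z * u)).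
rewrite mulrDr half.
set J := beta_integral z 1; set e := cpow _ _ => h.
(* The number [e = 2^(-z)] has modulus [2^(- Re z) < 1], so it differs from 1 and the factor [1 - e]
   can be cancelled. *)
have e1 : 1 - e != 0.
  rewrite subr_eq0; apply/eqP => /(congr1 (@normc R)); rewrite normc1 normc_cpow//.
  move/eqP; apply/negP; rewrite eq_sym /powR (gt_eqF h0) lnV ?posrE// mulrN.
  by rewrite lt_eqF// expR_lt1 oppr_lt0 mulr_gt0// ln_gt0 ?ltr1n.
apply: (mulfI e1).
by rewrite mulr1 mulrBl mul1r mulrCA {1}h addrC addKr.
Qed.

(** The integral is the total mass of the exponential density of rate 1. *)
Lemma Gamma1 : Gamma (1 : R[i]) = 1.
Proof.
rewrite -[1 in LHS]/(1%:C) Gamma_real//; congr (_%:C).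
rewrite Rintegral_itv_obnd_cbnd; last exact: integrable_gamma_kernel.
rewrite Rintegral_mkcond.
rewrite /Rintegral -[RHS]/(fine 1%E) -(@integral_exponential_pdf R 1 ltr01).
congr fine; apply: eq_integral => t _; congr (_%:E).
rewrite patchE; case: ifPn.
  rewrite inE/= in_itv/= andbT => t0.
  by rewrite exponential_pdfE// subrr powRr0 !mul1r mulN1r.
rewrite notin_setE/= in_itv/= andbT => /negP; rewrite -ltNge => t0.
by rewrite lt0_exponential_pdf.
Qed.

(** The relation [Gamma_beta] at [q = 1], with [Gamma 1 = 1] and [B(z, 1) = 1 / z], takes the place
    of an integration by parts. *)
Lemma GammaS z : 0 < Re z -> Gamma (z + 1) = z * Gamma z.
Proof.
move=> z0; have := Gamma_beta z0 (lexx (Re (1 : R[i]))).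
rewrite Gamma1 mulr1 => ->.
by rewrite mulrCA beta_integral1// mulr1.
Qed.

Lemma Re_nat n : Re (n%:R : R[i]) = n%:R.
Proof. by rewrite -(rmorph_nat (real_complex R)). Qed.

Lemma Gamma_nat n : Gamma (n.+1%:R : R[i]) = n`!%:R.
Proof.
elim: n => [|n ih]; first by rewrite Gamma1.
by rewrite -addn1 natrD GammaS ?Re_nat ?ltr0n// ih factS natrM.
Qed.

(** The inequality [ln v <= v - 1] is used at [v = u] if [u >= 1] and at [v = 1 / u] otherwise. The
    bound is rational in [u], so that integrating it against a gamma kernel only produces values of
    Gamma at shifted arguments. *)
Lemma sqr_ln_le (u : R) : 0 < u -> ln u ^+ 2 <= (u - 1) ^+ 2 + (1 - u^-1) ^+ 2.
Proof.
move=> u0; have ln_le (v : R) : 0 < v -> ln v <= v - 1.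
  by move=> v0; rewrite -{1}[v](subrK 1) addrC le_ln1Dx//; lra.
have h1 := ln_le _ u0; have := ln_le u^-1; rewrite invr_gt0 lnV// => /(_ u0) h2.
have [u1|u1] := leP 1 u.
  have l0 := ln_ge0 u1.
  rewrite -[leLHS]addr0 lerD ?sqr_ge0// ler_pXn2r// nnegrE; lra.
have l0 : ln u <= 0 by rewrite ln_le0// ltW.
rewrite -[leLHS]add0r lerD ?sqr_ge0// -(sqrrN (ln u)) -(sqrrN (1 - u^-1)).
rewrite ler_pXn2r ?nnegrE//; lra.
Qed.

Lemma normr_sin_le (v : R) : `|sin v| <= `|v|.
Proof.
have pos (v' : R) : 0 < v' -> `|sin v'| <= v'.
  move=> v0.
  have [c _] := @MVT R sin cos 0 v' v0 (fun t _ => is_derive_sin t)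
    (continuous_subspaceT (@continuous_sin R)).
  rewrite sin0 !subr0 => ->; rewrite normrM (gtr0_norm v0) ler_piMl ?(ltW v0)//.
  by rewrite ler_norml cos_geN1 cos_le1.
have [v0|v0|->] := ltgtP v 0; last by rewrite sin0.
  by rewrite -normrN -sinN -[leRHS]normrN [leRHS]gtr0_norm ?oppr_gt0// pos ?oppr_gt0.
by rewrite [leRHS]gtr0_norm// pos.
Qed.

(** Half-angle formula [cos u = 1 - 2 sin^2 (u / 2)], together with [|sin v| <= |v|]. *)
Lemma cos_ge (u : R) : 1 - u ^+ 2 / 2 <= cos u.
Proof.
have -> : u = u / 2 + u / 2 by rewrite -splitr.
rewrite cosD; have := cos2Dsin2 (u / 2); rewrite !expr2.
have := normr_sin_le (u / 2); rewrite -ler_sqr ?nnegrE// !real_normK ?num_real//.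
by rewrite !expr2; lra.
Qed.

(** This is the sign of the integral of the minorant [h] in [Gamma_neq0_large], with [Y = (Im z)^2]
    and [v = 2 / N]. The three products are hints for [nra]. *)
Lemma variance_bound_gt0 (N Y v : R) : 0 <= Y -> 3 * Y + 4 < N -> 0 < v -> v < 1 ->
  0 < (N - 1) * (N - 2) + - (Y / 2) * (2 * N - 1 + v).
Proof.
move=> Y0 NY v0 v1.
have h1 : 0 <= Y * (1 - v) by apply: mulr_ge0; lra.
have h2 : 0 <= (N - 3 * Y - 4) * N by apply: mulr_ge0; lra.
have h3 : 0 <= (N - 4) * (N - 4) by apply: mulr_ge0; lra.
nra.
Qed.

(* With N = Re z, y = Im z, the real part of N^(-iy) Gamma z is the integral of
   t^(N-1) e^(-t) cos (y ln (t/N)). The gamma distribution of parameter N has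
   mean N and variance N, hence ln (t/N) is small in mean square: bounding
   (ln u)^2 by (u - 1)^2 + (1 - 1/u)^2 reduces its mean square to moments of
   order -2 to 2. *)
Lemma Gamma_neq0_large z : 3 * Im z ^+ 2 + 4 < Re z -> Gamma z != 0.
Proof.
set N := Re z; set y := Im z => Nbig.
have y2 : 0 <= y ^+ 2 by exact: sqr_ge0.
have N4 : 4 < N by lra.
have N0 : 0 < N by lra.
pose g (s t : R) := t `^ (s - 1) * expR (- t).
pose G s := \int[mu]_(t in `]0, +oo[) g s t.
have GE s : 0 < s -> Gamma s%:C = (G s)%:C by move=> s0; exact: Gamma_real.
have GS s : 0 < s -> G (s + 1) = s * G s.
  move=> s0; have := @GammaS s%:C s0.
  rewrite -[1]/(1%:C) -rmorphD !GE//; last by rewrite addr_gt0.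
  by rewrite -rmorphM => /complexI.
(* [G M] is the moment of order -2; the functional equation reduces the other four to multiples of
   it. *)
pose M := N - 2.
have M0 : 0 < M by rewrite /M; lra.
have G0 : 0 < G M by have := Gamma_real_gt0 M0; rewrite GE.
have G1 : G (M + 1) = M * G M by exact: GS.
have [M1 M2 M3 M4] : [/\ 0 < M + 1, 0 < M + 2, 0 < M + 3 & 0 < M + 4].
  by split; rewrite addr_gt0.
have G2 : G (M + 2) = (M + 1) * M * G M.
  by rewrite -[2]natr1 addrA (GS _ M1) G1 mulrA.
have G3 : G (M + 3) = (M + 2) * (M + 1) * M * G M.
  by rewrite -[3]natr1 addrA (GS _ M2) G2 !mulrA.
have G4 : G (M + 4) = (M + 3) * (M + 2) * (M + 1) * M * G M.
  by rewrite -[4]natr1 addrA (GS _ M3) G3 !mulrA.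
apply/eqP => Gz0.
pose c : R[i] := cpow N (0 -i* y).
have zint := cintegrable_gamma_kernel (N0 : 0 < Re z).
have : Re (c * Gamma z) = 0 by rewrite Gz0 mulr0.
rewrite GammaE// -cintegralZ// => I0.
have [iR _] := cintegrableZ c (measurable_itv _) zint.
pose k := - (y ^+ 2 / 2).
(* This is [g N t * (1 + k ((t / N - 1)^2 + (1 - N / t)^2))] expanded in powers of [t], a minorant
   of the cosine integrand by [cos_ge] and [sqr_ln_le]. *)
pose h t := k / N ^+ 2 * g (M + 4) t + (- (2 * k / N) * g (M + 3) t +
  ((1 + 2 * k) * g (M + 2) t + (- (2 * k * N) * g (M + 1) t + k * N ^+ 2 * g M t))).
have iZ (r s : R) : 0 < s -> mu.-integrable `]0, +oo[ (EFin \o (fun t => r * g s t)).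
  move=> s0; rewrite (_ : _ \o _ = (fun t => r%:E * (g s t)%:E)%E)//.
  by apply: integrableZl => //; exact: integrable_gamma_kernel.
have iD (f1 f2 : R -> R) : mu.-integrable `]0, +oo[ (EFin \o f1) ->
    mu.-integrable `]0, +oo[ (EFin \o f2) ->
    mu.-integrable `]0, +oo[ (EFin \o (fun t => f1 t + f2 t)).
  move=> i1 i2; rewrite (_ : _ \o _ = (fun t => (f1 t)%:E + (f2 t)%:E)%E)//.
  exact: integrableD.
have ig s : 0 < s -> mu.-integrable `]0, +oo[ (EFin \o g s).
  exact: integrable_gamma_kernel.
have i0 := iZ (k * N ^+ 2) _ M0.
have i1 := iD _ _ (iZ (- (2 * k * N)) _ M1) i0.
have i2 := iD _ _ (iZ (1 + 2 * k) _ M2) i1.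
have i3 := iD _ _ (iZ (- (2 * k / N)) _ M3) i2.
have ih : mu.-integrable `]0, +oo[ (EFin \o h) := iD _ _ (iZ (k / N ^+ 2) _ M4) i3.
have hI : \int[mu]_(t in `]0, +oo[) h t =
    ((N - 1) * (N - 2) + k * (2 * N - 1 + 2 / N)) * G M.
  rewrite /h (RintegralD _ (iZ _ _ M4) i3)// (RintegralD _ (iZ _ _ M3) i2)//.
  rewrite (RintegralD _ (iZ _ _ M2) i1)// (RintegralD _ (iZ _ _ M1) i0)//.
  rewrite !RintegralZl//; do ?exact: ig.
  rewrite -!/(G _) G1 G2 G3 G4 /M; field; rewrite gt_eqF//.
have hpos : 0 < \int[mu]_(t in `]0, +oo[) h t.
  rewrite hI pmulr_lgt0//.
  apply: variance_bound_gt0 => //; first by rewrite divr_gt0.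
  by rewrite ltr_pdivrMr// mul1r (lt_trans _ N4)// ltr_nat.
(* If Gamma vanished at [z], the cosine integrand would have integral 0 while dominating [h], whose
   integral is positive. *)
move: hpos; apply/negP; rewrite -leNgt -[leRHS]I0.
apply: le_Rintegral => // t /itv0y_gt0 t0.
have -> : Re (c * gamma_kernel z t) = g N t * cos (y * ln (t / N)).
  rewrite /c /gamma_kernel mulrA /cpow -cexpD Re_Mreal Re_cexp.
  rewrite /g /powR gt_eqF// mulrAC ln_div//.
  rewrite ReD ImD !ReM !ImM ReD ImD ReN ImN -/N -/y /=.
  by congr (expR _ * _ * cos _); ring.
have -> : h t = g N t * (1 + k * ((t / N - 1) ^+ 2 + (1 - (t / N)^-1) ^+ 2)).
  have gS s : g (s + 1) t = t * g s t.
    rewrite /g addrK mulrA; congr (_ * _).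
    by rewrite mulrC -{3}(powRr1 (ltW t0)) -powRD ?subrK// (gt_eqF t0) implybT.
  have g1 : g (M + 1) t = t * g M t by exact: gS.
  have g2 : g (M + 2) t = t ^+ 2 * g M t.
    by rewrite -[2]natr1 addrA gS g1 mulrA.
  have g3 : g (M + 3) t = t ^+ 3 * g M t.
    by rewrite -[3 in LHS]natr1 addrA gS g2 mulrA -exprS.
  have g4 : g (M + 4) t = t ^+ 4 * g M t.
    by rewrite -[4 in LHS]natr1 addrA gS g3 mulrA -exprS.
  have gN : g N t = t ^+ 2 * g M t by rewrite -g2; congr (g _ _); rewrite /M; ring.
  by rewrite /h g1 g2 g3 g4 gN; field; rewrite !gt_eqF.
rewrite ler_wpM2l ?mulr_ge0 ?powR_ge0 ?expR_ge0//.
apply: le_trans (cos_ge _).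
rewrite lerD2l exprMn /k mulNr lerN2 mulrAC ler_wpM2l ?divr_ge0//.
by apply: sqr_ln_le; rewrite divr_gt0.
Qed.

(** By the functional equation a zero at [z] propagates to every [z + n]. These points keep the
    imaginary part of [z] while their real part grows, so they reach the region of
    [Gamma_neq0_large]. *)
Lemma Gamma_neq0 z : 0 < Re z -> Gamma z != 0.
Proof.
move=> z0; apply/eqP => Gz0.
have G0 n : Gamma (z + n%:R) = 0.
  elim: n => [|n ih]; first by rewrite addr0.
  by rewrite -addn1 natrD addrA GammaS ?ih ?mulr0// ReD Re_nat ltr_pwDl.
pose n := (Num.truncn (3 * Im z ^+ 2 + 4)).+1.
have /eqP := G0 n; apply/negP; apply: Gamma_neq0_large.
have In : Im (n%:R : R[i]) = 0 by rewrite -(rmorph_nat (real_complex R)).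
rewrite ImD In addr0 ReD Re_nat; apply: (lt_trans (truncnS_gt _)).
by rewrite ltrDr.
Qed.

(** In the product [z (z + 1) ... (z + n - 1) Gamma z] only the first factor [z] can have modulus
    below 1, hence the minimum. *)
Lemma Gamma_shift_ge z n : 0 < Re z ->
  Num.min 1 (Re z) * normc (Gamma z) <= normc (Gamma (z + n%:R)).
Proof.
move=> z0; have m0 : 0 <= Num.min 1 (Re z) by rewrite le_min ler01 ltW.
have m1 : Num.min 1 (Re z) <= 1 by rewrite ge_min lexx.
elim: n => [|n ih]; first by rewrite addr0 ler_piMl ?normc_ge0.
have zn : 0 < Re (z + n%:R) by rewrite ReD Re_nat ltr_pwDl.
rewrite -addn1 natrD addrA GammaS// normcM.
case: n ih zn => [|n] ih zn.
  rewrite addr0 ler_wpM2r ?normc_ge0// (le_trans _ (normc_Re_le _))//.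
  by rewrite (gtr0_norm z0) ge_min lexx orbT.
apply: (le_trans ih); rewrite ler_peMl ?normc_ge0//.
rewrite (le_trans _ (normc_Re_le _))// (gtr0_norm zn) ReD Re_nat.
by rewrite (le_trans _ (lerD (ltW z0) (lexx _)))// add0r ler1n.
Qed.

(** Here each factor [z + k] has modulus at least [k + 1]. *)
Lemma Gamma_shift_ge_fact z n : 1 <= Re z ->
  n`!%:R * normc (Gamma z) <= normc (Gamma (z + n%:R)).
Proof.
move=> z1; have z0 : 0 < Re z by exact: lt_le_trans z1.
elim: n => [|n ih]; first by rewrite addr0 mul1r.
have zn : 0 < Re (z + n%:R) by rewrite ReD Re_nat ltr_pwDl.
rewrite -{2}addn1 natrD addrA GammaS// normcM factS natrM -mulrA.
apply: ler_pM => //; first by rewrite mulr_ge0// normc_ge0.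
rewrite (le_trans _ (normc_Re_le _))// (gtr0_norm zn) ReD Re_nat.
by rewrite -addn1 natrD addrC lerD.
Qed.

End gamma_function.

(** * Complex series: convergence by comparison and termwise integration *)

Section complex_series.
Context {R : realType}.
Notation mu := (@lebesgue_measure R).
Implicit Types (u : nat -> R[i]) (k l z : R[i]).

(** Convergence is taken componentwise so that real limit theorems apply; [ccvg_cvg] transfers it to
    the modulus topology in which [cseries] is defined. *)
Definition ccvg u l :=
  ((fun n => Re (u n)) @ \oo --> Re l) /\ ((fun n => Im (u n)) @ \oo --> Im l).

Lemma Re_series u n : Re (series u n) = series (fun r => Re (u r)) n.
Proof.
rewrite /series/=; elim: n => [|n ih]; first by rewrite !big_geq.
by rewrite !big_nat_recr//= ReD ih.
Qed.

Lemma Im_series u n : Im (series u n) = series (fun r => Im (u r)) n.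
Proof.
rewrite /series/=; elim: n => [|n ih]; first by rewrite !big_geq.
by rewrite !big_nat_recr//= ImD ih.
Qed.

Lemma normc_series_le u (v : nat -> R) n : (forall r, normc (u r) <= v r) ->
  normc (series u n) <= series v n.
Proof.
move=> uv; rewrite /series/=; elim: n => [|n ih]; first by rewrite !big_geq// normc0.
by rewrite !big_nat_recr//= (le_trans (le_normcD _ _))// lerD.
Qed.

Lemma ccvg_cvg u l : ccvg u l -> (u : nat -> R[i]^o) @ \oo --> (l : R[i]^o).
Proof.
move=> [cR cI]; apply/cvgrPdist_lt => /= e e0.
(* In the order of [R[i]] a positive [e] is real, hence equal to its real part. *)
have e0' : 0 < Re e by move: e0; rewrite ltcE => /andP[].
have eE : e = (Re e)%:C.
  by move: e0; rewrite ltcE => /andP[/eqP h _]; case: e h e0' => r i /= ->.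
have e20 : 0 < Re e / 2 by rewrite divr_gt0.
move/cvgrPdist_lt : cR => /(_ _ e20) hR; move/cvgrPdist_lt : cI => /(_ _ e20) hI.
near=> n.
rewrite eE -[`|l - u n|]/(normc (l - u n))%:C ltcR.
apply: (le_lt_trans (normc_le_ReIm _)); rewrite [ltRHS]splitr ltrD//.
- by rewrite ReD ReN; near: n.
- by rewrite ImD ImN; near: n.
Unshelve. all: by end_near. Qed.

Lemma ccvg_cseries u l : ccvg (series u) l -> cseries u = l.
Proof.
move=> /ccvg_cvg ul; apply: cvg_lim ul.
exact: (@norm_hausdorff _ R[i]^o).
Qed.

Lemma ccvgMl k u l : ccvg u l -> ccvg (fun n => k * u n) (k * l).
Proof.
move=> [cR cI]; rewrite /ccvg ReM ImM; split.
- under eq_fun do rewrite ReM.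
  by apply: cvgB; apply: cvgM => //; exact: cvg_cst.
- under eq_fun do rewrite ImM.
  by apply: cvgD; apply: cvgM => //; exact: cvg_cst.
Qed.

Lemma ccvg_seriesMl k u l :
  ccvg (series u) l -> ccvg (series (fun r => k * u r)) (k * l).
Proof.
move=> /(ccvgMl k); rewrite (_ : (fun n => _) = series (fun r => k * u r))//.
by apply/funext => n; rewrite /series/= mulr_sumr.
Qed.

Lemma eq_ccvg_series u u' l : u =1 u' -> ccvg (series u) l -> ccvg (series u') l.
Proof. by move=> /funext ->. Qed.

Lemma ccvg_series_dominated u (v : nat -> R) : cvgn (series v) ->
  (forall r, normc (u r) <= v r) -> ccvg (series u) (cseries u).
Proof.
move=> cv uv.
have key (P : R[i] -> R) : (forall z, `|P z| <= normc z) ->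
    cvgn (series (fun r => P (u r))).
  move=> Ple; apply: normed_cvg; apply: series_le_cvg cv => //= r.
  - by rewrite (le_trans (normc_ge0 (u r))).
  - exact: le_trans (uv r).
have cR := key _ (@normc_Re_le R); have cI := key _ (@normc_Im_le R).
have h : ccvg (series u) (limn (series (fun r => Re (u r))) +i*
    limn (series (fun r => Im (u r)))).
  split => /=.
  - by under eq_fun do rewrite Re_series.
  - by under eq_fun do rewrite Im_series.
by rewrite (ccvg_cseries h).
Qed.

Lemma ccvg_normc u l : ccvg u l -> (fun n => normc (u n)) @ \oo --> normc l.
Proof.
move=> [cR cI].
have E z : normc z = Num.sqrt (Re z ^+ 2 + Im z ^+ 2) by case: z.
rewrite E; under eq_fun do rewrite E.
apply: continuous_cvg; first exact: sqrt_continuous.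
by apply: cvgD; rewrite expr2; under eq_fun do rewrite expr2; exact: cvgM.
Qed.

(** Dominated convergence: with [V] the sum of the [v r], every partial sum is bounded in modulus by
    the integrable function [V h]. *)
Lemma cintegral_series D (f : nat -> R -> R[i]) (h : R -> R) (v : nat -> R) :
  measurable D -> (forall r, cmeasurable D (f r)) ->
  cvgn (series v) -> (forall r, 0 <= v r) ->
  (forall r t, D t -> normc (f r t) <= v r * h t) ->
  (forall t, D t -> 0 <= h t) ->
  mu.-integrable D (EFin \o h) ->
  ccvg (series (fun r => cintegral D (f r)))
    (cintegral D (fun t => cseries (fun r => f r t))).
Proof.
move=> mD mf cv v0 fvh h0 ih; pose V := limn (series v).
have vV n : series v n <= V.
  apply: nondecreasing_cvgn_le => //; apply/nondecreasing_seqP => m.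
  by rewrite /series/= big_nat_recr//= lerDl.
have cvt t : D t -> cvgn (series (fun r => v r * h t)).
  move=> Dt; rewrite (_ : series _ = (fun n => series v n * h t)).
    by apply: is_cvgM => //; exact: is_cvg_cst.
  by apply/funext => n; rewrite /series/= mulr_suml.
have pt t : D t -> ccvg (series (fun r => f r t)) (cseries (fun r => f r t)).
  by move=> Dt; apply: (ccvg_series_dominated (cvt t Dt)) => r; exact: fvh.
have bd n t : D t -> normc (series (fun r => f r t) n) <= V * h t.
  move=> Dt; apply: (le_trans (normc_series_le _ (fun r => fvh r t Dt))).
  by rewrite /series/= -mulr_suml ler_wpM2r ?h0//; exact: vV.
have iVh : mu.-integrable D (EFin \o (fun t => V * h t)).
  rewrite (_ : _ \o _ = (fun t => V%:E * (h t)%:E)%E)//.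
  exact: integrableZl.
have fi r : cintegrable D (f r).
  apply: (cintegrable_dominated (h := fun t => v r * h t)) => //; first exact: fvh.
  rewrite (_ : _ \o _ = (fun t => (v r)%:E * (h t)%:E)%E)//.
  exact: integrableZl.
have sE n : cintegrable D (fun t => series (fun r => f r t) n) /\
    series (fun r => cintegral D (f r)) n = cintegral D (fun t => series (fun r => f r t) n).
  elim: n => [|n [iS ih']].
    split.
      apply: (@eq_cintegrable _ _ (fun=> 0)) => //.
        by move=> t _; rewrite /series/= big_geq.
      by split; exact: integrable0.
    rewrite /series/= big_geq// (@eq_cintegral _ _ _ (fun=> 0)).
      by rewrite /cintegral/= !Rintegral_cst// !mul0r.
    by move=> t _; rewrite big_geq.
  have SS t : series (fun r => f r t) n.+1 = series (fun r => f r t) n + f n t.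
    by rewrite /series/= big_nat_recr.
  split.
    by apply: (eq_cintegrable mD (fun t _ => esym (SS t))); exact: cintegrableD.
  rewrite (@eq_cintegral _ _ _ _ (fun t _ => SS t)) cintegralD// -ih'.
  by rewrite /series/= big_nat_recr.
have key (P : R[i] -> R) : (forall z, `|P z| <= normc z) ->
    (forall n, measurable_fun D (fun t => P (series (fun r => f r t) n))) ->
    (forall t, D t -> (fun n => P (series (fun r => f r t) n)) @ \oo
       --> P (cseries (fun r => f r t))) ->
    (fun n => \int[mu]_(t in D) P (series (fun r => f r t) n)) @ \oo -->
    \int[mu]_(t in D) P (cseries (fun r => f r t)).
  move=> Ple mP cP.
  have mP' n : measurable_fun D (fun t => (P (series (fun r => f r t) n))%:E).
    exact/measurable_EFinP.
  have mPl : measurable_fun D (fun t => (P (cseries (fun r => f r t)))%:E).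
    apply: (emeasurable_fun_cvg (fun n t => (P (series (fun r => f r t) n))%:E)) => //.
    by move=> t Dt; apply: cvg_EFin; [exact: nearW|exact: cP].
  have cE t : D t -> (fun n => (P (series (fun r => f r t) n))%:E) @ \oo -->
      (P (cseries (fun r => f r t)))%:E.
    by move=> Dt; apply: cvg_EFin; [exact: nearW|exact: cP].
  have le t n : D t -> (`|(P (series (fun r => f r t) n))%:E| <= (V * h t)%:E)%E.
    by move=> Dt; rewrite lee_fin (le_trans (Ple _))// bd.
  have ae1 : {ae mu, forall t, D t -> (fun n => (P (series (fun r => f r t) n))%:E) @ \oo -->
      (P (cseries (fun r => f r t)))%:E}.
    exact: aeW.
  have ae2 : {ae mu, forall t n, D t ->
      (`|(P (series (fun r => f r t) n))%:E| <= (EFin \o (fun t => V * h t)%R) t)%E}.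
    exact: aeW.
  have [i _] := @dominated_convergence _ _ R mu D mD _ _ _ mP' mPl ae1 iVh ae2.
  have fin : (\int[mu]_(t in D) (P (cseries (fun r => f r t)))%:E)%E \is a fin_num.
    exact: integrable_fin_num.
  by rewrite -(fineK fin) => /fine_cvg.
split.
- under eq_fun do rewrite (sE _).2.
  apply: key.
  + exact: normc_Re_le.
  + by move=> n; case: (sE n).1 => /measurable_int/measurable_EFinP.
  + by move=> t Dt; case: (pt t Dt).
- under eq_fun do rewrite (sE _).2.
  apply: key.
  + exact: normc_Im_le.
  + by move=> n; case: (sE n).1 => _ /measurable_int/measurable_EFinP.
  + by move=> t Dt; case: (pt t Dt).
Qed.

End complex_series.

(** * The Struve series: size of the coefficients and behaviour near the origin *)

Section struve_series.
Context {R : realType}.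
Notation mu := (@lebesgue_measure R).
Implicit Types (nu c rho beta z : R[i]) (r n : nat) (t X : R).

Lemma Re_three_half : Re (3 / 2 : R[i]) = 3 / 2.
Proof.
rewrite (_ : 3 / 2 = (3 / 2 : R)%:C)//.
by rewrite rmorphM fmorphV !rmorph_nat.
Qed.

Definition struve_coef nu c r : R[i] :=
  (- c) ^+ r / (Gamma (r%:R + nu + 3 / 2) * Gamma (r%:R + 3 / 2)).

(** Of the two Gamma factors in the denominator, the first stays away from 0 and the second is at
    least a constant times [r!]. *)
Lemma struve_coef_le nu c : 0 < Re (nu + 3 / 2) ->
  exists2 K : R, 0 <= K &
    forall r, normc (struve_coef nu c r) <= K * (normc c ^+ r / r`!%:R).
Proof.
move=> nu0.
have h0 : 0 < Re (3 / 2 : R[i]) by rewrite Re_three_half divr_gt0.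
have h1 : 1 <= Re (3 / 2 : R[i]) by rewrite Re_three_half ler_pdivlMr// mul1r ler_nat.
have npos z : 0 < Re z -> 0 < normc (Gamma z).
  by move=> z0; rewrite lt_neqAle normc_ge0 andbT eq_sym normc_eq0 Gamma_neq0.
pose m := Num.min 1 (Re (nu + 3 / 2)) * normc (Gamma (nu + 3 / 2)).
have m0 : 0 < m by rewrite mulr_gt0 ?npos// lt_min ltr01.
pose m' := normc (Gamma (3 / 2 : R[i])).
have m'0 : 0 < m' by exact: npos.
exists (m * m')^-1 => [|r]; first by rewrite invr_ge0 mulr_ge0 ?ltW.
rewrite /struve_coef normcM normcV normcX normcN normcM.
rewrite mulrCA ler_wpM2l ?exprn_ge0 ?normc_ge0// -invfM.
have f0 : 0 < r`!%:R :> R by rewrite ltr0n fact_gt0.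
have A : m <= normc (Gamma (r%:R + nu + 3 / 2)).
  by rewrite -addrA addrC; exact: Gamma_shift_ge.
have B : r`!%:R * m' <= normc (Gamma (r%:R + 3 / 2)).
  by rewrite addrC; exact: Gamma_shift_ge_fact.
have P1 := lt_le_trans m0 A; have P2 := lt_le_trans (mulr_gt0 f0 m'0) B.
rewrite lef_pV2 ?posrE ?(mulr_gt0 P1 P2) ?(mulr_gt0 (mulr_gt0 m0 m'0) f0)//.
rewrite -mulrA [m' * _]mulrC; apply: ler_pM A B; first exact: ltW.
by apply: ltW; exact: mulr_gt0.
Qed.

Lemma struve_cpowE nu t r : 0 < t ->
  cpow (t / 2) (2 * r%:R + nu + 1) = cpow (t / 2) (nu + 1) * ((t / 2) ^+ (2 * r))%:C.
Proof.
by move=> t0; rewrite -addrA [_ + (nu + 1)]addrC (cpowD _ (nu + 1)) -natrM cpow_nat ?divr_gt0.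
Qed.

Lemma cvg_series_expM (K y : R) : cvgn (series (fun r => K * (y ^+ r / r`!%:R))).
Proof.
rewrite (_ : (fun r => _) = K *: exp_coeff y)//.
exact/is_cvg_seriesZ/is_cvg_series_exp_coeff.
Qed.

(** Once [(t / 2)^(nu + 1)] is factored out, the terms of index [r >= 1] keep a factor
    [(t / 2)^(2 r)], at most [t] when [t <= 1]. The tail is thus at most [t V], where [V] is the sum
    of a majorant series independent of [t]. *)
Lemma normc_struve_ge nu c : 0 < Re (nu + 3 / 2) ->
  exists2 V : R, 0 <= V & forall t, 0 < t <= 1 ->
    (t / 2) `^ (Re nu + 1) * (normc (struve_coef nu c 0) - t * V) <=
    normc (struve nu c t).
Proof.
move=> nu0; have [K K0 cK] := struve_coef_le c nu0.
pose v r := K * (normc c ^+ r / r`!%:R).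
have v0 r : 0 <= v r by rewrite mulr_ge0// divr_ge0 ?exprn_ge0 ?normc_ge0.
have cv : cvgn (series v) by exact: cvg_series_expM.
have nds : nondecreasing_seq (series v).
  by apply/nondecreasing_seqP => m; rewrite /series/= big_nat_recr//= lerDl.
exists (limn (series v)).
  by apply: (le_trans _ (nondecreasing_cvgn_le nds cv 0)); rewrite /series/= big_geq.
move=> t /andP[t0 t1]; have th0 : 0 < t / 2 by rewrite divr_gt0.
have th1 : t / 2 <= t by rewrite ler_pdivrMr// ler_peMr ?ltW// ltr1n.
pose u r := struve_coef nu c r * ((t / 2) ^+ (2 * r))%:C.
have pow r : normc ((t / 2) ^+ (2 * r))%:C = (t / 2) ^+ (2 * r).
  by rewrite normc_real ger0_norm// exprn_ge0// ltW.
have uv r : normc (u r) <= v r.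
  rewrite normcM pow -[leRHS]mulr1 ler_pM ?normc_ge0 ?exprn_ge0 ?(ltW th0)//.
  by rewrite exprn_ile1 ?(ltW th0)// (le_trans th1).
have uS r : normc (u r.+1) <= t * v r.+1.
  rewrite normcM pow mulrC ler_pM ?normc_ge0 ?exprn_ge0 ?(ltW th0)//.
  apply: (le_trans _ th1); rewrite mulnS addSn exprS ler_piMr ?(ltW th0)//.
  by rewrite exprn_ile1 ?(ltW th0)// (le_trans th1).
have cu := ccvg_series_dominated cv uv.
have -> : struve nu c t = cpow (t / 2) (nu + 1) * cseries u.
  apply: ccvg_cseries; apply: (eq_ccvg_series _ (ccvg_seriesMl (cpow (t / 2) (nu + 1)) cu)).
  by move=> r; rewrite /u struve_cpowE// mulrCA.
rewrite [leRHS]normcM normc_cpow// ReD ler_wpM2l ?powR_ge0//.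
apply: (cvgr_to_ge (ccvg_normc cu)); near=> n.
(* The partial sum must contain the term of index 0, which is to be separated from the tail. *)
have [k ->] : exists k, n = k.+1.
  by exists n.-1; rewrite prednK//; near: n; exact: nbhs_infty_gt.
have tail : normc (series u k.+1 - u 0) <= t * series v k.+1.
  elim: k => [|k ih].
    by rewrite /series/= !big_nat1 subrr normc0 mulr_ge0// ltW.
  have -> : series u k.+2 - u 0 = (series u k.+1 - u 0) + u k.+1.
    by rewrite /series/= [in LHS]big_nat_recr//= addrAC.
  apply: (le_trans (le_normcD _ _)).
  by rewrite [in leRHS]/series/= big_nat_recr//= mulrDr lerD.
rewrite lerBlDr (_ : struve_coef nu c 0 = u 0); last by rewrite /u muln0 expr0 mulr1.
rewrite -{1}(subKr (series u k.+1) (u 0)) (le_trans (le_normcD _ _))//.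
rewrite normcN lerD// (le_trans tail)// ler_wpM2l ?(ltW t0)//.
exact: nondecreasing_cvgn_le.
Unshelve. all: by end_near. Qed.

(** The integral of [k / t] over [[e, d]] is [k ln (d / e)], which exceeds any bound as [e] tends to
    0. *)
Lemma not_integrable_inv (k d : R) (g : R -> R) : 0 < k -> 0 < d ->
  (forall t, 0 < t <= d -> k / t <= g t) ->
  mu.-integrable `]0, d] (EFin \o g) -> False.
Proof.
move=> k0 d0 kg ig; pose M := \int[mu]_(t in `]0, d]) g t.
have g0 t : `]0, d]%classic t -> 0 <= g t.
  rewrite /= in_itv/= => /[dup] /andP[t0 _] /kg; apply: le_trans.
  by rewrite divr_ge0 ?ltW.
have M0 : 0 <= M by exact: Rintegral_ge0.
(* Chosen so that [k ln (d / e) = M + 1], more than the whole integral [M] of [g]. *)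
pose e := d * expR (- ((M + 1) / k)).
have e0 : 0 < e by rewrite mulr_gt0 ?expR_gt0.
have ed : e < d.
  by rewrite gtr_pMr// expR_lt1 oppr_lt0 divr_gt0// ltr_wpDl.
have sub : `[e, d]%classic `<=` (`]0, d]%classic : set R).
  by apply: subset_itvr; rewrite bnd_simp.
have pos t : t \in `[e, d] -> 0 < t by rewrite in_itv/= => /andP[/(lt_le_trans e0)].
have ige : mu.-integrable `[e, d] (EFin \o g) by exact: integrableS ig.
have ik : mu.-integrable `[e, d] (EFin \o (fun t => k * t `^ (- 1))).
  apply: le_integrable ige => //.
    apply/measurable_EFinP/measurable_funTS; apply: measurable_funM => //.
  move=> t /= te; have t0 := pos t te.
  rewrite lee_fin powR_inv1 ?(ltW t0)// ger0_norm ?divr_ge0 ?(ltW k0) ?(ltW t0)//.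
  rewrite (le_trans _ (ler_norm _))// kg// t0/=.
  by move: te; rewrite in_itv/= => /andP[].
have dln t : 0 < t -> is_derive t 1 (fun s => k * ln s) (k * t `^ (- 1)).
  move=> t0; have dl := is_derive1_ln t0; apply: is_derive_eq.
  by rewrite powR_inv1 ?(ltW t0).
have cln t : 0 < t -> {for t, continuous (fun s => k * ln s)}.
  move=> t0; apply: differentiable_continuous; apply/derivable1_diffP.
  by case: (dln t t0).
have Ik : \int[mu]_(t in `[e, d]) (k * t `^ (- 1)) = M + 1.
  rewrite /Rintegral (@continuous_FTC2 _ _ (fun s => k * ln s))//.
  - rewrite /= -mulrBr /e lnM ?posrE ?expR_gt0// expRK.
    by field; rewrite gt_eqF.
  - apply: continuous_in_subspaceT => t; rewrite inE/= => /pos t0.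
    by apply: cvgM; [exact: cvg_cst|exact: continuous_powR_gt0].
  - split.
    + by move=> t /subset_itv_oo_cc /pos /dln [].
    + by apply: cvg_at_right_filter; exact: cln.
    + by apply: cvg_at_left_filter; exact: cln.
  - move=> t /subset_itv_oo_cc /pos t0; rewrite derive1E.
    by case: (dln t t0).
have : M + 1 <= M.
  rewrite -[leLHS]Ik; apply: (@le_trans _ _ (\int[mu]_(t in `[e, d]) g t)).
    apply: le_Rintegral => // t /= te; have t0 := pos t te.
    rewrite powR_inv1 ?(ltW t0)// kg// t0/=.
    by move: te; rewrite in_itv/= => /andP[].
  rewrite /M /Rintegral fine_le//.
  - exact: integrable_fin_num.
  - exact: integrable_fin_num.
  - by apply: ge0_subset_integral => //; case/integrableP: ig.
by rewrite gerDl ler10.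
Qed.

(* The first term of the series dominates near 0, and [t ^ (rho + nu)] is not
   integrable there unless [Re (rho + nu) > - 1]. *)
Lemma Re_gt0_of_integrable nu c rho X : 0 < X -> 0 < Re (nu + 3 / 2) ->
  cintegrable `]0, X[ (fun t => cpow t (rho - 1) * struve nu c t) ->
  0 < Re (rho + nu + 1).
Proof.
move=> X0 nu0 fi; rewrite ltNge; apply/negP => gam0.
have [V V0 lb] := normc_struve_ge c nu0.
pose b := normc (struve_coef nu c 0).
have b0 : 0 < b.
  rewrite lt_neqAle normc_ge0 andbT eq_sym normc_eq0 /struve_coef expr0 mul1r.
  rewrite invr_eq0 mulf_neq0// !add0r Gamma_neq0// Re_three_half//.
(* The bound 1 allows [normc_struve_ge], [X / 2] keeps []0, d]] inside []0, X[], and the last one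
   gives [t V <= b / 2]; its [V + 1] avoids a division by 0. *)
pose d := Num.min 1 (Num.min (X / 2) (b / (2 * (V + 1)))).
have V1 : 0 < V + 1 by rewrite ltr_wpDl.
have d0 : 0 < d.
  by rewrite !lt_min ltr01 !divr_gt0// mulr_gt0.
have [d1 dX db] : [/\ d <= 1, d <= X / 2 & d <= b / (2 * (V + 1))].
  by split; rewrite !ge_min lexx ?orbT.
have dX' : d < X by rewrite (le_lt_trans dX)// ltr_pdivrMr// ltr_pMr// ltr1n.
have mX : measurable (`]0, X[%classic : set R) by exact: measurable_itv.
have ni := cintegrable_normc mX fi.
have sub : `]0, d]%classic `<=` (`]0, X[%classic : set R).
  by apply: subset_itvl; rewrite bnd_simp.
pose k := 2^-1 `^ (Re nu + 1) * (b / 2).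
have k0 : 0 < k by rewrite mulr_gt0 ?powR_gt0 ?invr_gt0 ?divr_gt0.
have nid : mu.-integrable `]0, d]
    (EFin \o (fun t => normc (cpow t (rho - 1) * struve nu c t))).
  exact: integrableS ni.
apply: (not_integrable_inv k0 d0 _ nid).
move=> t /andP[t0 td]; have t1 : t <= 1 by exact: le_trans d1.
rewrite normcM normc_cpow//.
have h : b / 2 <= b - t * V.
  have : t * V <= b / 2.
    apply: (@le_trans _ _ (b / (2 * (V + 1)) * (V + 1))); last first.
      by rewrite le_eqVlt; apply/orP; left; apply/eqP; field; rewrite gt_eqF.
    by rewrite ler_pM// ?(ltW t0) ?(le_trans td)// lerDl.
  by lra.
have {lb} := lb t; rewrite t0 t1 => /(_ isT) lb.
apply: (@le_trans _ _ (t `^ (Re (rho - 1)) * ((t / 2) `^ (Re nu + 1) * (b / 2)))); last first.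
  rewrite ler_wpM2l ?powR_ge0// (le_trans _ lb)//.
  by rewrite ler_wpM2l ?powR_ge0.
rewrite powRM ?invr_ge0 ?(ltW t0)// -mulrA mulrA -powRD; last first.
  by rewrite (gt_eqF t0) implybT.
(* The exponent of [t] is now [Re (rho + nu) <= -1], and [t <= 1], so the power is at least
   [1 / t]. *)
rewrite -/k [leLHS]mulrC ler_wpM2r ?(ltW k0)// -powR_inv1 ?(ltW t0)//.
apply: ger_powR; first by rewrite t0.
by move: gam0; rewrite !ReD ReN/=; lra.
Qed.

Lemma cpow_half z : cpow 2^-1 z = (cpow 2 z)^-1 :> R[i].
Proof.
apply: (mulIf (cpow_neq0 2 z)); rewrite mulVf ?cpow_neq0// -cpowM ?invr_gt0//.
by rewrite mulVf// cpow1l.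
Qed.

Lemma struve_term_beta nu c rho beta X t r : 0 < t ->
  cpow (1 - t / X) beta * (cpow t (rho - 1) *
    (struve_coef nu c r * cpow (t / 2) (2 * r%:R + nu + 1))) =
  struve_coef nu c r * cpow 2^-1 (2 * r%:R + nu + 1) *
    beta_kernel (rho + nu + 1 + 2 * r%:R) (beta + 1) X t.
Proof.
move=> t0; rewrite /beta_kernel addrK cpowM ?invr_gt0//.
rewrite (_ : rho + nu + 1 + 2 * r%:R - 1 = (rho - 1) + (2 * r%:R + nu + 1)); last by ring.
rewrite (cpowD t (rho - 1)); move: (cpow _ _) (cpow _ _) (cpow _ _) (cpow _ _) => *.
by ring.
Qed.

End struve_series.

(** * Termwise integration of the Struve series against the beta kernel *)

Section struve_integral.
Context {R : realType}.
Implicit Types (nu c rho beta z : R[i]) (r n : nat) (t X : R).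

Lemma beta_integralE (p q : R[i]) : 0 < Re p -> 1 <= Re q ->
  beta_integral p q = Gamma p * Gamma q / Gamma (p + q).
Proof.
move=> p0 q1; rewrite Gamma_beta// mulrC mulKf//.
by rewrite Gamma_neq0// ReD ltr_pwDl// (le_trans _ q1).
Qed.

Lemma struve_ccvg nu c t : 0 < t -> 0 < Re (nu + 3 / 2) ->
  ccvg (series (fun r => struve_coef nu c r * cpow (t / 2) (2 * r%:R + nu + 1)))
    (struve nu c t).
Proof.
move=> t0 nu0; have [K K0 cK] := struve_coef_le c nu0.
have th0 : 0 < t / 2 by rewrite divr_gt0.
apply: (@ccvg_series_dominated _ _ (fun r => K * normc (cpow (t / 2) (nu + 1)) *
  ((normc c * (t / 2) ^+ 2) ^+ r / r`!%:R))) => [|r].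
  exact: cvg_series_expM.
rewrite struve_cpowE// normcM [normc (_ * _%:C)]normcM normc_real.
rewrite ger0_norm ?exprn_ge0 ?(ltW th0)//.
rewrite [leRHS](_ : _ = (K * (normc c ^+ r / r`!%:R)) *
  (normc (cpow (t / 2) (nu + 1)) * (t / 2) ^+ (2 * r))).
  by rewrite ler_wpM2r ?mulr_ge0 ?normc_ge0 ?exprn_ge0 ?(ltW th0).
rewrite exprMn -exprM; move: (normc _) (_ ^+ (2 * r)) (r`!%:R^-1) => x y z.
by ring.
Qed.

Lemma struve_pathway nu c rho beta X : 0 < X -> 0 < Re (nu + 3 / 2) ->
  0 < Re (rho + nu + 1) -> 0 <= Re beta ->
  ccvg (series (fun r => struve_coef nu c r * cpow 2^-1 (2 * r%:R + nu + 1) *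
    (cpow X (rho + nu + 1 + 2 * r%:R) *
      (Gamma (rho + nu + 1 + 2 * r%:R) * Gamma (beta + 1) /
       Gamma (rho + nu + 1 + 2 * r%:R + (beta + 1))))))
    (cintegral `]0, X[ (fun t => cpow (1 - t / X) beta *
      (cpow t (rho - 1) * struve nu c t))).
Proof.
move=> X0 nu0 gam0 beta0; set gam := rho + nu + 1.
have Rr r : Re (2 * r%:R : R[i]) = (2 * r)%:R by rewrite -natrM Re_nat.
have gamr r : 0 < Re (gam + 2 * r%:R) by rewrite ReD Rr ltr_pwDl.
have beta1 : 1 <= Re (beta + 1) by rewrite ReD lerDr.
have [K K0 cK] := struve_coef_le c nu0.
pose d r := struve_coef nu c r * cpow 2^-1 (2 * r%:R + nu + 1).
pose f r t := d r * beta_kernel (gam + 2 * r%:R) (beta + 1) X t.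
have mX : measurable (`]0, X[%classic : set R) by exact: measurable_itv.
have lim t : `]0, X[%classic t -> cseries (fun r => f r t) =
    cpow (1 - t / X) beta * (cpow t (rho - 1) * struve nu c t).
  rewrite /= in_itv/= => /andP[t0 _]; apply: ccvg_cseries.
  have := struve_ccvg c t0 nu0.
  move=> /(ccvg_seriesMl (cpow t (rho - 1))) /(ccvg_seriesMl (cpow (1 - t / X) beta)).
  by apply: eq_ccvg_series => r; rewrite struve_term_beta.
rewrite -(eq_cintegral lim).
pose h t := t `^ (Re gam - 1).
(* The factor [t^(2 r)] of the kernel is bounded by [X^(2 r)]; with the coefficient bound and the
   powers of 1/2 this leaves an exponential series in [|c| (X / 2)^2]. *)
pose v r := K * 2^-1 `^ (Re nu + 1) * ((normc c * (X / 2) ^+ 2) ^+ r / r`!%:R).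
have X2 : 0 < X / 2 by rewrite divr_gt0.
apply: (eq_ccvg_series _ (@cintegral_series _ _ f h v mX _ _ _ _ _ _)).
- move=> r; rewrite cintegralZ//; last exact: cintegrable_beta_kernel.
  by rewrite cintegral_beta_kernel// beta_integralE.
- move=> r; apply: cmeasurableM; first exact: cmeasurable_cst.
  exact: cmeasurableS (cmeasurable_beta_kernel _ _ _).
- exact: cvg_series_expM.
- move=> r; rewrite /v !mulr_ge0 ?powR_ge0 ?invr_ge0 ?exprn_ge0 ?mulr_ge0 ?normc_ge0 ?(ltW X0)//.
- move=> r t; rewrite /= in_itv/= => tX; have /andP[t0 tltX] := tX.
  rewrite normcM; apply: (@le_trans _ _ (normc (d r) * (h t * X ^+ (2 * r)))).
    rewrite ler_wpM2l ?normc_ge0// (le_trans (normc_beta_kernel_le _ beta1 tX))//.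
    rewrite ReD Rr addrAC powRD ?(gt_eqF t0) ?implybT//.
    rewrite ler_wpM2l ?powR_ge0// powR_mulrn ?(ltW t0)//.
    by rewrite lerXn2r ?nnegrE ?(ltW t0) ?(ltW X0) ?(ltW tltX).
  rewrite mulrCA mulrC ler_wpM2r ?powR_ge0//.
  rewrite normcM normc_cpow ?invr_gt0// !ReD Rr -addrA powRD ?invr_eq0 ?pnatr_eq0 ?implybT//.
  rewrite powR_mulrn ?invr_ge0//.
  rewrite /v [leRHS](_ : _ = (K * (normc c ^+ r / r`!%:R)) *
    (2^-1 ^+ (2 * r) * 2^-1 `^ (Re nu + 1)) * X ^+ (2 * r)).
    by rewrite !ler_wpM2r ?mulr_ge0 ?powR_ge0 ?exprn_ge0 ?invr_ge0 ?(ltW X0).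
  rewrite exprMn -exprM exprMn.
  move: (_ `^ _) (normc c ^+ r) (_ ^+ (2 * r)) (_ ^+ (2 * r)) (r`!%:R^-1).
  by move=> *; ring.
- by move=> t _; exact: powR_ge0.
- have i := integrable_powR gam0 X0.
  by apply: integrableS i => //; apply: subset_itvl; rewrite bnd_simp.
Qed.

End struve_integral.

(* In the order of R[i], - (3 / 2) < nu says that nu is real and greater than
   - 3 / 2 (the imaginary parts must agree, see ltcE). *)
Theorem corollary2p1 (R : realType) (a x alpha : R) (eta rho nu c : R[i])
  (a_gt0 : 0 < a) (x_gt0 : 0 < x) (alpha_lt1 : alpha < 1)
  (eta_gt0 : 0 < Re eta) (rho_gt0 : 0 < Re rho)
  (nu_gt : - (3 / 2) < nu)
  (eta_alpha_gt : - 1 < Re (eta / (1 - alpha)%:C))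
  (f_int : cintegrable `]0, x / (a * (1 - alpha))[
             (fun t : R => cpow t (rho - 1) * struve nu c t)) :
  pathway a eta alpha (fun t : R => cpow t (rho - 1) * struve nu c t) x =
  cpow x eta * cpow (x / (a * (1 - alpha))) (rho + nu + 1)
  * (Gamma (1 + eta / (1 - alpha)%:C) / cpow 2 (nu + 1))
  * wright [:: (rho + nu + 1, 2); (1, 1)]
           [:: (rho + nu + eta / (1 - alpha)%:C + 2, 2);
               (nu + 3 / 2, 1); (3 / 2, 1)]
           (- (c * (x ^+ 2)%:C / (4 * a ^+ 2 * (1 - alpha) ^+ 2)%:C)).
Proof.
have al0 : 0 < 1 - alpha by rewrite subr_gt0.
set X := x / (a * (1 - alpha)) in f_int *.
have X0 : 0 < X by rewrite divr_gt0 ?mulr_gt0.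
have XE t : a * (1 - alpha) * t / x = t / X.
  by rewrite /X; field; rewrite !gt_eqF.
set beta := eta / (1 - alpha)%:C in eta_alpha_gt *.
have beta0 : 0 < Re beta.
  by rewrite /beta -real_complexV Re_Mreal mulr_gt0// invr_gt0.
have nu0 : 0 < Re (nu + 3 / 2).
  move: nu_gt; rewrite ltcE => /andP[_]; rewrite ReN Re_three_half ReD Re_three_half.
  by rewrite -subr_gt0 opprK.
have gam0 := Re_gt0_of_integrable X0 nu0 f_int.
have := struve_pathway c X0 nu0 gam0 (ltW beta0).
rewrite /pathway -/beta -/X.
rewrite (_ : cintegral _ (fun t => cpow (1 - a * (1 - alpha) * t / x) beta * _) =
  cintegral `]0, X[ (fun t => cpow (1 - t / X) beta *
      (cpow t (rho - 1) * struve nu c t))); last first.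
  by apply: eq_cintegral => t _; rewrite XE.
set I := cintegral _ _ => cI.
(* [C] collects the factors common to all terms. As it is nonzero, the series of [cI] can be divided
   by it, which also yields the convergence of the Wright series. *)
pose C := cpow X (rho + nu + 1) * (Gamma (1 + beta) / cpow 2 (nu + 1)).
have beta1 : 0 < Re (1 + beta) by rewrite ReD ltr_wpDl.
have G1 := Gamma_neq0 beta1; have c2 := cpow_neq0 2 (nu + 1).
have cX := cpow_neq0 X (rho + nu + 1).
have C0 : C != 0 by exact: mulf_neq0 cX (mulf_neq0 G1 (invr_neq0 c2)).
rewrite /wright; set w := (X in cseries X).
suff cw : ccvg (series w) (C^-1 * I).
  transitivity (cpow x eta * (C * (C^-1 * I))); first by rewrite mulVKf.
  by rewrite (ccvg_cseries cw) /C !mulrA.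
apply: eq_ccvg_series (ccvg_seriesMl C^-1 cI) => r; rewrite /w.
rewrite big_cons big_seq1 2!big_cons big_seq1.
have n2 : (2 : R)%:C = 2 by rewrite rmorph_nat.
(* The upper pair [(1, 1)] contributes [Gamma (1 + r) = r!], which cancels the factorial in the
   Wright series. *)
rewrite /= n2 !mul1r nat1r Gamma_nat /struve_coef.
rewrite (_ : rho + nu + beta + 2 + 2 * r%:R = rho + nu + 1 + 2 * r%:R + (beta + 1)); last by ring.
rewrite (_ : nu + 3 / 2 + r%:R = r%:R + nu + 3 / 2); last by ring.
rewrite [3 / 2 + _]addrC [beta + 1]addrC.
rewrite (cpowD X) -natrM cpow_nat//.
rewrite cpow_half (_ : (2 * r)%:R + nu + 1 = nu + 1 + (2 * r)%:R); last by ring.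
rewrite (cpowD 2) cpow_nat//.
(* The Wright argument is [- c (X / 2)^2]. Its [r]-th power supplies [(-c)^r] from the Struve
   coefficient, [X^(2 r)] from [X^p] and [2^(- 2 r)] from the power of 1/2. *)
rewrite (_ : - (c * _ / _) = - c * ((X / 2) ^+ 2)%:C); last first.
  rewrite mulNr -mulrA; congr (- (c * _)).
  rewrite -fmorphV -rmorphM; congr (_%:C).
  by rewrite /X; field; rewrite !gt_eqF.
have -> : (- c * ((X / 2) ^+ 2)%:C) ^+ r =
    (- c) ^+ r * (X ^+ (2 * r))%:C / (2 ^+ (2 * r))%:C.
  rewrite exprMn -mulrA; congr (_ * _).
  by rewrite -(rmorphXn (real_complex R)) -exprM expr_div_n rmorphM fmorphV.
have two0 : (2 ^+ (2 * r))%:C != 0 :> R[i].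
  by rewrite (fmorph_eq0 (real_complex R)) expf_neq0.
have f0 : r`!%:R != 0 :> R[i] by rewrite pnatr_eq0 -lt0n fact_gt0.
have g0 : Gamma (rho + nu + 1 + (2 * r)%:R + (1 + beta)) != 0.
  by rewrite Gamma_neq0// ReD ReD Re_nat addr_gt0// ltr_pwDl.
have g1 : Gamma (r%:R + nu + 3 / 2) != 0.
  by rewrite Gamma_neq0// -addrA ReD Re_nat ltr_wpDl.
have g2 : Gamma (r%:R + 3 / 2 : R[i]) != 0.
  by rewrite Gamma_neq0// ReD Re_nat Re_three_half ltr_wpDl.
rewrite /C; move: two0 f0 g0 g1 g2 G1 c2 cX.
(* With Gamma values and powers abstracted into variables, the equality of terms is a rational
   identity. *)
move: (Gamma (rho + nu + 1 + (2 * r)%:R)) (Gamma (rho + nu + 1 + _ + _)).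
move: (Gamma (r%:R + nu + 3 / 2)) (Gamma (r%:R + 3 / 2 : R[i])) (Gamma (1 + beta)).
move: (cpow 2 _) (cpow X _) ((2 ^+ _)%:C) ((X ^+ _)%:C) (r`!%:R) ((- c) ^+ r).
move=> A1 A2 A3 A4 A5 A6 A7 A8 A9 A10 A11 h1 h2 h3 h4 h5 h6 h7 h8.
by field; do ?[apply/andP; split].
Qed.
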